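(* Let $E/\mathbb{Q}$ be the elliptic curve $y^2=x^3+a_4x+a_6$ with $a_4,a_6\in\mathbb{Z}$. Let $(u,v)\in\mathbb{Z}^2$ be map-suitable for $E$, and suppose that $-D_E(u,v)$ is a negative fundamental discriminant. Then the map $\Phi_{u,v}:E(\mathbb{Q})\to \mathrm{CL}(-D_E(u,v))$ is a group homomorphism.
   Context: For integers $u,v$ put $d_E(u,v):=v(u^3+a_4uv^2-a_6v^3)$ and $D_E(u,v):=4d_E(u,v)$. A pair $(u,v)\in\mathbb{Z}^2$ is called map-suitable for $E$ if $u$, $v$, $3u^2+a_4v^2$ and $D_E(u,v)$ are all positive. The class group $\mathrm{CL}(-D)$ is identified with the group of $\mathrm{SL}_2(\mathbb{Z})$-classes of primitive positive definite integral binary quadratic forms of discriminant $-D$ (Gauss composition). Every point $P\neq\mathcal{O}$ of $E(\mathbb{Q})$ can be written uniquely as $P=(A/C^2,B/C^3)$ with $A,B,C\in\mathbb{Z}$, $C>0$, $\gcd(A,C)=\gcd(B,C)=1$. For such $P$ set $a:=Av+C^2u$, $g:=\gcd(C,v)$, choose an integer $\mu$ with $\frac{C^3}{g^2}\mu\equiv 1\pmod{\frac{va}{g^2}}$, and let $\Phi_{u,v}(P)$ be the class of the form $$\frac{va}{g^2}x^2+2\mu\frac{Bv^2}{g^2}xy+\frac{\mu^2\frac{B^2v^4}{g^4}+d_E(u,v)}{\frac{va}{g^2}}y^2,$$ which is a positive definite integral form of discriminant $-D_E(u,v)$ whose class does not depend on the choice of $\mu$; set $\Phi_{u,v}(\mathcal{O})$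 to be the identity class. *)

(* Defs.v *)
From mathcomp Require Import all_boot all_order all_algebra.
Set Implicit Arguments. Unset Strict Implicit. Unset Printing Implicit Defensive.
Import Order.TTheory GRing.Theory Num.Theory.
Local Open Scope ring_scope.

(* Points of E(Q): None is the point at infinity O, Some (x,y) an affine point. *)
Definition ptQ := option (rat * rat).

Definition on_curve (a4 a6 : int) (P : ptQ) : bool :=
  match P with
  | None => true
  | Some (x, y) => y ^+ 2 == x ^+ 3 + a4%:~R * x + a6%:~R
  end.

Definition ec_add (a4 : int) (P Q : ptQ) : ptQ :=
  match P, Q with
  | None, _ => Q
  | _, None => P
  | Some (x1, y1), Some (x2, y2) =>
      if x1 == x2 then
        if y1 == - y2 then None
        else let l := (3%:R * x1 ^+ 2 + a4%:~R) / (2%:R * y1) in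
             let x3 := l ^+ 2 - x1 - x2 in
             Some (x3, l * (x1 - x3) - y1)
      else let l := (y2 - y1) / (x2 - x1) in
           let x3 := l ^+ 2 - x1 - x2 in
           Some (x3, l * (x1 - x3) - y1)
  end.

Definition dE (a4 a6 u v : int) : int := v * (u ^+ 3 + a4 * u * v ^+ 2 - a6 * v ^+ 3).
Definition DE (a4 a6 u v : int) : int := 4 * dE a4 a6 u v.

Definition map_suitable (a4 a6 u v : int) : Prop :=
  0 < u /\ 0 < v /\ 0 < 3 * u ^+ 2 + a4 * v ^+ 2 /\ 0 < DE a4 a6 u v.

Definition squarefree_int (n : int) : Prop :=
  forall p : nat, prime p -> ~~ (p * p %| `|n|%N)%N.

Definition fundamental_disc (Delta : int) : Prop :=
  ((Delta %% 4)%Z = 1 /\ squarefree_int Delta) \/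
  ((Delta %% 4)%Z = 0 /\
   (((Delta %/ 4)%Z %% 4)%Z = 2 \/ ((Delta %/ 4)%Z %% 4)%Z = 3) /\
   squarefree_int (Delta %/ 4)%Z).

(* (a, b, c) represents a x^2 + b x y + c y^2 *)
Definition bqf := (int * int * int)%type.

Definition bqf_disc (f : bqf) : int := let: (a, b, c) := f in b ^+ 2 - 4 * a * c.

(* the form f(p x + q y, r x + s y) *)
Definition bqf_act (f : bqf) (p q r s : int) : bqf :=
  let: (a, b, c) := f in
  (a * p ^+ 2 + b * p * r + c * r ^+ 2,
   2 * a * p * q + b * (p * s + q * r) + 2 * c * r * s,
   a * q ^+ 2 + b * q * s + c * s ^+ 2).

Definition bqf_equiv (f g : bqf) : Prop :=
  exists p q r s : int, p * s - q * r = 1 /\ g = bqf_act f p q r s.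

(* Gauss composition, in Dirichlet's explicit form (Cox, Primes of the form
   x^2+ny^2, Lemma 3.2 / Prop. 3.8): for f1 = (a1,b1,c1), f2 = (a2,b2,c2) of the
   same discriminant Dl with gcd(a1, a2, (b1+b2)/2) = 1, the form
   F = (a1 a2, B, (B^2 - Dl)/(4 a1 a2)) with B = b1 mod 2a1, B = b2 mod 2a2,
   B^2 = Dl mod 4 a1 a2 represents the product class [f1]*[f2]. *)
Definition dirichlet_comp (f1 f2 F : bqf) : Prop :=
  let: (a1, b1, c1) := f1 in
  let: (a2, b2, c2) := f2 in
  let: (A, B, C) := F in
  let Dl := bqf_disc f1 in
  [/\ bqf_disc f2 = Dl, bqf_disc F = Dl, a1 != 0 & a2 != 0] /\
  [/\ gcdz (gcdz a1 a2) ((b1 + b2) %/ 2)%Z = 1, A = a1 * a2,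
      (B == b1 %[mod 2 * a1])%Z, (B == b2 %[mod 2 * a2])%Z &
      (B ^+ 2 == Dl %[mod 4 * a1 * a2])%Z].

(* For P = (x,y) on E with x = A/C^2, y = B/C^3 in lowest terms,
   A = numq x, B = numq y, C^2 = denq x, C^3 = denq y, so C = denq y / denq x. *)
Definition Phi (a4 a6 u v : int) (P : ptQ) : bqf :=
  let d := dE a4 a6 u v in
  match P with
  | None => (1, 0, d)
  | Some (x, y) =>
      let A := numq x in
      let B := numq y in
      let C := (denq y %/ denq x)%Z in
      let a := A * v + C ^+ 2 * u in
      let g := gcdz C v in
      let m := ((v * a) %/ g ^+ 2)%Z in
      let k := ((C ^+ 3) %/ g ^+ 2)%Z in
      let mu := (egcdz k m).1 in   (* k * mu = 1 mod m *)
      let Bv2 := ((B * v ^+ 2) %/ g ^+ 2)%Z in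
      (m, 2 * mu * Bv2,
       ((mu ^+ 2 * ((B ^+ 2 * v ^+ 4) %/ g ^+ 4)%Z + d) %/ m)%Z)
  end.

(* Main.v *)
Require Import Defs.
From mathcomp Require Import all_boot all_order all_algebra all_field.
From mathcomp Require Import ring zify.
Import Order.TTheory GRing.Theory Num.Theory.
Local Open Scope ring_scope.

(** Put [w^2 = -d], where [d = dE a4 a6 u v], so that R = (-u/v, w/v^2) is a point
    of the curve over Q(w). A form (m, 2h, c) of discriminant -4d corresponds to the
    lattice L = Z m + Z (h - w), an ideal of O = Z[w]; the lattice of Phi(P), scaled
    by g = gcd(C, v), lies in the ideal generated by the 2x2 minors of R and P, i.e.
    the ideal modulo which P and R coincide.

    If P1 + P2 + P3 = 0, the three points are cut out by a primitive integral line l.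
    Modulo l(R) the point R lies on that line and on the cubic, and by Gauss's lemma
    the cubic restricted to the line is the product of the three linear forms
    vanishing at the Pi; hence L1 L2 L3 lies in a principal ideal generated by a
    multiple b of l(R), and N(b) = m1 m2 m3. Since d is squarefree and
    d = 1, 2 mod 4, the forms are primitive, so m_i is in L_i times its conjugate.
    This turns the inclusion into m1 m2 L(P1 + P2) being inside conj(b) L1 L2.
    An inclusion of lattices with the right norms is an equivalence of forms, and
    Dirichlet's composite contains the product lattice L1 L2. *)

(** * Forms as lattices in Z[w] *)

Section QuadraticLattice.

Context (K : numClosedFieldType) (d : int) (w : K).
Hypotheses (d_gt0 : 0 < d) (w2 : w ^+ 2 = - d%:~R) (conj_w : w^* = - w).

Definition inL (a h : int) (z : K) : Prop :=
  exists x y : int, z = x%:~R * a%:~R + y%:~R * (h%:~R - w).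

(** The values [a = 1], [h = 0] give the order Z[w] itself, so the order and its ideals share the
    same closure lemmas. *)
Notation inO := (inL 1 0).

Lemma conj_int (x : int) : (x%:~R : K)^* = x%:~R.
Proof. exact: rmorph_int. Qed.

Lemma coord_inj (x y x' y' : int) :
  x%:~R + y%:~R * w = x'%:~R + y'%:~R * w -> x = x' /\ y = y'.
Proof.
move=> e; have ec : x%:~R - y%:~R * w = x'%:~R - y'%:~R * w.
  have := congr1 (fun z : K => z^*) e.
  by rewrite !rmorphD !rmorphM /= !conj_int conj_w !mulrN.
have w0 : w != 0.
  by rewrite -sqrf_eq0 w2 oppr_eq0 intr_eq0 gt_eqF.
have ex : (2 * x)%:~R = (2 * x')%:~R :> K.
  have -> : (2 * x)%:~R = (x%:~R + y%:~R * w) + (x%:~R - y%:~R * w) :> K by ring.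
  by rewrite e ec; ring.
have {}ex : x = x' by move/intr_inj/(mulfI (isT : 2 != 0 :> int)): ex.
split=> //; move: e; rewrite ex => /addrI /(mulIf w0); exact: intr_inj.
Qed.

Lemma inOP (x y : int) : inO (x%:~R + y%:~R * w).
Proof. by exists x, (- y); ring. Qed.

Lemma inO_int (x : int) : inO x%:~R.
Proof. by exists x, 0; ring. Qed.

Lemma inO_w : inO w.
Proof. by exists 0, (-1); ring. Qed.

Lemma inL_l (a h : int) : inL a h a%:~R.
Proof. by exists 1, 0; ring. Qed.

Lemma inL_r (a h : int) : inL a h (h%:~R - w).
Proof. by exists 0, 1; ring. Qed.

Lemma inLD (a h : int) (z t : K) : inL a h z -> inL a h t -> inL a h (z + t).
Proof. by move=> [x [y ->]] [x' [y' ->]]; exists (x + x'), (y + y'); ring. Qed.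

(** Stability under [w]: w a = h a - a (h - w) and w (h - w) = c a - h (h - w), the latter because a
    c is the norm of h - w. *)
Lemma inLM (a h c : int) (z t : K) :
  h ^+ 2 + d = a * c -> inO z -> inL a h t -> inL a h (z * t).
Proof.
move=> e [x [y ->]] [x' [y' ->]].
exists ((x + y * -h) * x' - y * y' * c), (x * y' + y * a * x' + y * y' * h).
have {}e : d%:~R = a%:~R * c%:~R - h%:~R ^+ 2 :> K.
  by rewrite -intrM -e; ring.
have w2' : w ^+ 2 = h%:~R ^+ 2 - a%:~R * c%:~R by rewrite w2 e; ring.
ring: w2'.
Qed.

Lemma inOM (z t : K) : inO z -> inO t -> inO (z * t).
Proof. by apply: (@inLM 1 0 d); ring. Qed.

Lemma inON (z : K) : inO z -> inO (- z).
Proof. by rewrite -mulN1r; apply: inOM; exact: (inO_int (-1)). Qed.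

Lemma inO_conj (z : K) : inO z -> inO z^*.
Proof.
move=> [x [y ->]]; exists x, (- y).
by rewrite rmorphD !rmorphM rmorphB /= !conj_int conj_w; ring.
Qed.

Lemma inL_conj (a h : int) (z : K) : inL a h z -> inL a (- h) z^*.
Proof.
move=> [x [y ->]]; exists x, (- y).
by rewrite rmorphD !rmorphM rmorphB /= !conj_int conj_w; ring.
Qed.

(** A change of variables of determinant 1 is a change of basis of the lattice; scaling by [s] then
    turns the first basis vector back into an integer. *)
Lemma bqf_equiv_scale (a h c : int) (f : bqf) :
    0 < a -> h ^+ 2 + d = a * c -> bqf_equiv (a, 2 * h, c) f ->
  exists a1 h1 c1 : int, exists s : K,
    [/\ f = (a1, 2 * h1, c1), 0 < a1, h1 ^+ 2 + d = a1 * c1,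
        s * s^* * a%:~R = a1%:~R & forall z, inL a h z -> inL a1 h1 (s * z)].
Proof.
move=> a0 e [p [q [r [s [det ->]]]]]; rewrite /bqf_act.
set a1 := (X in (X, _, _)); set c1 := (X in (_, _, X)).
pose h1 := a * p * q + h * (p * s + q * r) + c * r * s.
have norm1 : a * a1 = (a * p + h * r) ^+ 2 + d * r ^+ 2.
  have -> : d = a * c - h ^+ 2 by rewrite -e; ring.
  by rewrite /a1; ring.
have a1_gt0 : 0 < a1.
  have [/eqP r0|r0] := boolP (r == 0); last first.
    have : 0 < a * a1.
      by rewrite norm1 ltr_wpDl ?sqr_ge0 // mulr_gt0 // exprn_even_gt0.
    by rewrite pmulr_rgt0.
  have p0 : p != 0 by apply/eqP => p0; move: det; rewrite p0 r0 mul0r mulr0 subr0.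
  rewrite /a1 r0 expr0n /= !mulr0 !addr0 mulr_gt0 // exprn_even_gt0 //.
have e1 : h1 ^+ 2 + d = a1 * c1.
  have : a1 * c1 - h1 ^+ 2 = (a * c - h ^+ 2) * (p * s - q * r) ^+ 2.
    by rewrite /a1 /c1 /h1; ring.
  by rewrite det expr1n mulr1 => E; rewrite -[RHS](subrK (h1 ^+ 2)) E -e; ring.
(* First vector of the new basis. Its norm is [a * a1], so the multiplier [a1 / th] has the norm
   [a1 / a] that is wanted. *)
pose th : K := p%:~R * a%:~R + r%:~R * (h%:~R - w).
have Nth : th * th^* = a%:~R * a1%:~R.
  rewrite -intrM norm1 /th rmorphD !rmorphM rmorphB /= !conj_int conj_w.
  by ring: w2.
have th0 : th != 0.
  apply/eqP=> t0; move: Nth; rewrite t0 mul0r -intrM => /esym/eqP.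
  by rewrite intr_eq0 mulf_eq0 !gt_eqF.
have thc0 : th^* != 0 by rewrite fmorph_eq0.
have a10 : (a1%:~R : K) != 0 by rewrite intr_eq0 gt_eqF.
have aK0 : (a%:~R : K) != 0 by rewrite intr_eq0 gt_eqF.
exists a1, h1, c1, (a1%:~R / th); split=> //.
- by congr (_, _, _); rewrite /h1; ring.
- rewrite rmorphM fmorphV /= conj_int.
  rewrite (_ : _ / th * _ * _ = a1%:~R * (a1%:~R * a%:~R) / (th * th^*)).
    by rewrite Nth; field; rewrite a10 aK0.
  by field; rewrite th0 thc0.
(* The second basis vector is sent to [h1 - w]; determinant 1 makes the coefficient of [w] equal to
   -1. *)
have key : a1%:~R * (q%:~R * a%:~R + s%:~R * (h%:~R - w)) = th * (h1%:~R - w).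
  pose t : K := h%:~R - w.
  have t2 : t ^+ 2 = 2 * h%:~R * t - a%:~R * c%:~R.
    by rewrite -intrM -e /t; ring: w2.
  have -> : h1%:~R - w = (p * s - q * r)%:~R * t + (a * p * q + 2 * h * q * r + c * r * s)%:~R.
    have -> : h1 = h + (a * p * q + 2 * h * q * r + c * r * s).
      have hE : h = h * (p * s - q * r) by rewrite det mulr1.
      by rewrite [X in X + _]hE /h1; ring.
    by rewrite det /t; ring.
  by rewrite /th /a1 -/t; ring: t2.
move=> z [x [y ->]].
(* Coordinates in the new basis, by the inverse matrix. *)
exists (x * s - y * q), (y * p - x * r).
have detK : p%:~R * s%:~R - q%:~R * r%:~R = 1 :> K by rewrite -!intrM -rmorphB det.
apply: (mulfI th0); rewrite mulrA (mulrC th) divfK //.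
have -> : th * ((x * s - y * q)%:~R * a1%:~R + (y * p - x * r)%:~R * (h1%:~R - w))
  = (x * s - y * q)%:~R * (th * a1%:~R) + (y * p - x * r)%:~R * (th * (h1%:~R - w)).
  by ring.
rewrite -key -[LHS](mulr1 _) -[X in _ * X = _]detK /th; ring.
Qed.

(** Converse passage from lattices to forms. The inclusion gives an integral matrix for
    multiplication by [s], and the norm of [s] forces its determinant to be 1. *)
Lemma scale_bqf_equiv (a h c A H C : int) (s : K) :
    0 < a -> 0 < A -> h ^+ 2 + d = a * c -> H ^+ 2 + d = A * C ->
    s * s^* * a%:~R = A%:~R -> (forall z, inL a h z -> inL A H (s * z)) ->
  bqf_equiv (a, 2 * h, c) (A, 2 * H, C).
Proof.
move=> a0 A0 e E Ns sL.
have [x [y ea]] := sL _ (inL_l a h).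
have [z [t eh]] := sL _ (inL_r a h).
have Aneq0 : A != 0 by rewrite gt_eqF.
have conjE (p q : int) :
    (p%:~R * A%:~R + q%:~R * (H%:~R - w))^* = p%:~R * A%:~R + q%:~R * (H%:~R + w).
  by rewrite rmorphD !rmorphM rmorphB /= !conj_int conj_w opprK.
have w2E : w ^+ 2 = H%:~R ^+ 2 - A%:~R * C%:~R.
  by rewrite w2 -intrM -E; ring.
have ha : a = A * x ^+ 2 + 2 * H * x * y + C * y ^+ 2.
  apply: (mulfI Aneq0); apply: (@intr_inj K); rewrite intrM -Ns.
  transitivity ((s * a%:~R) * (s * a%:~R)^*).
    by rewrite rmorphM /= conj_int; ring.
  by rewrite ea conjE; ring: w2E.
have hc : c = A * z ^+ 2 + 2 * H * z * t + C * t ^+ 2.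
  apply: (mulfI Aneq0); apply: (@intr_inj K); rewrite intrM -Ns.
  transitivity ((s * (h%:~R - w)) * (s * (h%:~R - w))^*).
    have -> : s * s^* * a%:~R * c%:~R = s * s^* * (a * c)%:~R by ring.
    by rewrite -e [(s * _)^*]rmorphM rmorphB /= conj_int conj_w; ring: w2.
  by rewrite eh conjE; ring: w2E.
(* The conjugate of s a times s (h - w) equals A (h - w): the rational part yields the middle
   coefficient, the [w] part the determinant. *)
have [hh det] : A * h = A * (A * x * z + H * (x * t + y * z) + C * y * t) /\
    - A = A * (y * z - x * t).
  apply: coord_inj.
  transitivity ((s * a%:~R)^* * (s * (h%:~R - w))).
    have -> : (A * h)%:~R + (- A)%:~R * w = A%:~R * (h%:~R - w) by ring.
    by rewrite -Ns rmorphM /= conj_int; ring.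
  by rewrite ea eh conjE; ring: w2E.
have {}hh := mulfI Aneq0 hh.
have {}det : x * t - y * z = 1.
  by apply: (mulfI Aneq0); rewrite mulr1 -[RHS]opprK det; ring.
(* The matrix above writes (a, h, c) in terms of (A, H, C), so its inverse is the one needed. *)
exists t, (- z), (- y), x; split; first by rewrite -det; ring.
have det2 (n : int) : n = n * (x * t - y * z) ^+ 2 by rewrite det expr1n mulr1.
by rewrite /bqf_act ha hh hc; congr (_, _, _);
  [rewrite {1}(det2 A)|rewrite {1}(det2 H)|rewrite {1}(det2 C)]; ring.
Qed.

(** As H is h1 modulo a1 and h2 modulo a2, [H - w] can replace the second generator of both
    lattices. Products stay in the composite lattice because (H - w)^2 = 2 H (H - w) - a1 a2 C. *)
Lemma dirichlet_comp_inL (a1 h1 c1 a2 h2 c2 : int) (F : bqf) :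
    h1 ^+ 2 + d = a1 * c1 -> h2 ^+ 2 + d = a2 * c2 ->
    dirichlet_comp (a1, 2 * h1, c1) (a2, 2 * h2, c2) F ->
  exists H C : int,
    [/\ F = (a1 * a2, 2 * H, C), H ^+ 2 + d = a1 * a2 * C
      & forall z1 z2, inL a1 h1 z1 -> inL a2 h2 z2 -> inL (a1 * a2) H (z1 * z2)].
Proof.
move=> e1 e2; case: F => [[A B] C] [[_ eF a10 a20] [_ AE eB1 eB2 _]]; subst A.
have discF : B ^+ 2 - 4 * (a1 * a2) * C = - 4 * d.
  have -> : d = a1 * c1 - h1 ^+ 2 by rewrite -e1; ring.
  by move: eF; rewrite /bqf_disc => ->; ring.
have /dvdzP[s1 s1E] : (2 * a1 %| B - 2 * h1)%Z by rewrite -eqz_mod_dvd.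
have /dvdzP[s2 s2E] : (2 * a2 %| B - 2 * h2)%Z by rewrite -eqz_mod_dvd.
pose H := h1 + s1 * a1.
have BE : B = 2 * H by rewrite -[LHS](subrK (2 * h1)) s1E /H; ring.
have H2 : H = h2 + s2 * a2.
  by apply: (@mulfI _ 2) => //; rewrite -BE -[LHS](subrK (2 * h2)) s2E; ring.
have EF : H ^+ 2 + d = a1 * a2 * C.
  apply: (@mulfI _ 4) => //; apply/eqP; rewrite -subr_eq0; apply/eqP.
  transitivity (B ^+ 2 - 4 * (a1 * a2) * C - - 4 * d); first by rewrite BE; ring.
  by rewrite discF subrr.
exists H, C; split=> //; first by rewrite BE.
move=> z1 z2 [x [y ->]] [z [t ->]].
exists ((x - y * s1) * (z - t * s2) - y * t * C),
  ((x - y * s1) * a1 * t + (z - t * s2) * a2 * y + 2 * H * y * t).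
have w2E : w ^+ 2 = H%:~R ^+ 2 - (a1 * a2)%:~R * C%:~R.
  by rewrite w2 -intrM -EF; ring.
have -> : h1%:~R - w = (H%:~R - w) - s1%:~R * a1%:~R by rewrite /H; ring.
have -> : h2%:~R - w = (H%:~R - w) - s2%:~R * a2%:~R by rewrite H2; ring.
by ring: w2E.
Qed.

Definition primitive_form (a b c : int) : Prop :=
  exists x y z : int, x * a + y * b + z * c = 1.

(** Products of generators with conjugate generators yield a times each of a, 2h (as a sum of two)
    and c; the Bezout coefficients combine these into [a]. *)
Lemma primitive_norm (a h c : int) :
    h ^+ 2 + d = a * c -> primitive_form a (2 * h) c ->
  exists x x' y y' : K, [/\ inL a h x, inL a h x', inL a h y, inL a h y'
    & a%:~R = x * x'^* + y * y'^*].
Proof.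
move=> e [p [q [r pqr]]].
exists a%:~R, (p%:~R * a%:~R + q%:~R * (h%:~R - w)),
  (h%:~R - w), (q%:~R * a%:~R + r%:~R * (h%:~R - w)).
split; [exact: inL_l | by exists p, q | exact: inL_r | by exists q, r |].
rewrite !rmorphD !rmorphM rmorphB /= !conj_int conj_w.
have w2E : w ^+ 2 = h%:~R ^+ 2 - a%:~R * c%:~R.
  by rewrite w2 -intrM -e; ring.
transitivity (a%:~R * (p * a + q * (2 * h) + r * c)%:~R : K).
  by rewrite pqr mulr1.
by ring: w2E.
Qed.

Lemma lattice_product_equiv (m1 h1 c1 m2 h2 c2 m3 h3 c3 : int) (b : K)
    (f1 f2 F : bqf) :
    0 < m1 -> 0 < m2 -> 0 < m3 ->
    h1 ^+ 2 + d = m1 * c1 -> h2 ^+ 2 + d = m2 * c2 -> h3 ^+ 2 + d = m3 * c3 ->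
    primitive_form m1 (2 * h1) c1 -> primitive_form m2 (2 * h2) c2 ->
    b * b^* = (m1 * m2 * m3)%:~R ->
    (forall x y z, inL m1 h1 x -> inL m2 h2 y -> inL m3 (- h3) z ->
       exists2 t, inO t & x * y * z = b * t) ->
    bqf_equiv (m1, 2 * h1, c1) f1 -> bqf_equiv (m2, 2 * h2, c2) f2 ->
    dirichlet_comp f1 f2 F -> bqf_equiv (m3, 2 * h3, c3) F.
Proof.
move=> m1_gt0 m2_gt0 m3_gt0 e1 e2 e3 prim1 prim2 Nb bP eq1 eq2.
have [a1 [k1 [l1 [s1 [-> a1_gt0 E1 Ns1 s1P]]]]] := bqf_equiv_scale _ _ _ _ m1_gt0 e1 eq1.
have [a2 [k2 [l2 [s2 [-> a2_gt0 E2 Ns2 s2P]]]]] := bqf_equiv_scale _ _ _ _ m2_gt0 e2 eq2.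
case/(dirichlet_comp_inL _ _ _ _ _ _ _ E1 E2) => H [C [-> EF FP]].
have intr0 (n : int) : 0 < n -> (n%:~R : K) != 0 by move=> n0; rewrite intr_eq0 gt_eqF.
have b0 : b != 0.
  apply/eqP=> b0; have := intr0 _ (mulr_gt0 (mulr_gt0 m1_gt0 m2_gt0) m3_gt0).
  by rewrite -Nb b0 mul0r eqxx.
have bc0 : b^* != 0 by rewrite fmorph_eq0.
(* The factor m1 m2 over the conjugate of b takes L3 into L1 L2, and s1 s2 takes L1 L2 into the
   product of the lattices of [f1] and [f2]. The whole multiplier has norm a1 a2 / m3. *)
apply: (scale_bqf_equiv _ _ _ _ _ _ (s1 * s2 * (m1 * m2)%:~R / b^* )) => //.
- exact: mulr_gt0.
- rewrite [(a1 * a2)%:~R]intrM -Ns1 -Ns2 !rmorphM fmorphV /= conjCK !conj_int.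
  have -> : s1 * s2 * (m1%:~R * m2%:~R) / b^* * (s1^* * s2^* * (m1%:~R * m2%:~R) / b) * m3%:~R
    = s1 * s1^* * m1%:~R * (s2 * s2^* * m2%:~R) * ((m1 * m2 * m3)%:~R / (b * b^* )).
    by field; rewrite b0 bc0.
  by rewrite Nb mulfV ?mulr1 // intr0 // !mulr_gt0.
move=> z Lz; have Lzc := inL_conj _ _ _ Lz.
have [x [x' [y [y' [Lx Lx' Ly Ly' m1E]]]]] := primitive_norm _ _ _ e1 prim1.
have [p [p' [q [q' [Lp Lp' Lq Lq' m2E]]]]] := primitive_norm _ _ _ e2 prim2.
have [t1 Ot1 t1E] := bP _ _ _ Lx Lp Lzc.
have [t2 Ot2 t2E] := bP _ _ _ Lx Lq Lzc.
have [t3 Ot3 t3E] := bP _ _ _ Ly Lp Lzc.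
have [t4 Ot4 t4E] := bP _ _ _ Ly Lq Lzc.
(* Writing m1 and m2 by [primitive_norm] expands m1 m2 times the conjugate of z into four triple
   products, each a multiple of b; then conjugate. *)
have key : (m1 * m2)%:~R * z = b^* * (t1^* * x' * p' + t2^* * x' * q'
    + t3^* * y' * p' + t4^* * y' * q').
  rewrite -[LHS]conjCK rmorphM /= conj_int intrM m1E m2E.
  have -> : (x * x'^* + y * y'^* ) * (p * p'^* + q * q'^* ) * z^*
    = (x * p * z^* ) * x'^* * p'^* + (x * q * z^* ) * x'^* * q'^*
      + (y * p * z^* ) * y'^* * p'^* + (y * q * z^* ) * y'^* * q'^* by ring.
  rewrite t1E t2E t3E t4E !rmorphD !rmorphM /= !conjCK; ring.
have -> : s1 * s2 * (m1 * m2)%:~R / b^* * z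
  = t1^* * ((s1 * x') * (s2 * p')) + t2^* * ((s1 * x') * (s2 * q'))
    + t3^* * ((s1 * y') * (s2 * p')) + t4^* * ((s1 * y') * (s2 * q')).
  rewrite (_ : s1 * s2 * _ / _ * z = s1 * s2 * ((m1 * m2)%:~R * z) / b^* ); last by ring.
  by rewrite key; field.
by do !apply: inLD; apply: inLM (EF) _ _; (try exact: inO_conj);
  apply: FP; (try exact: s1P); exact: s2P.
Qed.

(** * Points, lines and the ideal of their minors *)

Definition inO3 (r : K * K * K) : Prop := [/\ inO r.1.1, inO r.1.2 & inO r.2].

Definition dot3 (l r : K * K * K) : K := l.1.1 * r.1.1 + l.1.2 * r.1.2 + l.2 * r.2.

(** As [o] ranges over integral vectors, the values form the ideal generated by the 2x2 minors of
    [r] and [p]. *)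
Definition det3 (o r p : K * K * K) : K :=
  o.1.1 * (r.1.2 * p.2 - r.2 * p.1.2) + o.1.2 * (r.2 * p.1.1 - r.1.1 * p.2)
  + o.2 * (r.1.1 * p.1.2 - r.1.2 * p.1.1).

Definition int3 (p : int * int * int) : K * K * K :=
  (p.1.1%:~R, p.1.2%:~R, p.2%:~R).

Definition weierstrass (a4 a6 : int) (r : K * K * K) : K :=
  r.1.1 ^+ 3 + a4%:~R * r.1.1 * r.2 ^+ 2 + a6%:~R * r.2 ^+ 3 - r.1.2 ^+ 2 * r.2.

(* The line [l] meets the cubic in [p1 + p2 + p3]: since [dot3 e l = 1], the
   form [fun x => det3 e x p] is, on the line, a linear form vanishing at [p]. *)
Definition line_cuts (a4 a6 : int) (l p1 p2 p3 : int * int * int) : Prop :=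
  exists e : int * int * int,
    [/\ dot3 (int3 e) (int3 l) = 1, dot3 (int3 l) (int3 p1) = 0,
        dot3 (int3 l) (int3 p2) = 0, dot3 (int3 l) (int3 p3) = 0
      & forall x, dot3 (int3 l) x = 0 -> weierstrass a4 a6 x =
          det3 (int3 e) x (int3 p1) * det3 (int3 e) x (int3 p2)
          * det3 (int3 e) x (int3 p3)].

Lemma inO_nat (n : nat) : inO n%:R.
Proof. exact: (inO_int n). Qed.

Lemma inOX (z : K) (n : nat) : inO z -> inO (z ^+ n).
Proof.
move=> Oz; elim: n => [|n IH]; first exact: (inO_nat 1).
by rewrite exprS; apply: inOM.
Qed.

Ltac inO_closure := repeat first
  [ assumption | exact: inO_int | exact: inO_w | exact: inO_nat
  | apply: inLD | apply: inON | apply: inOM | apply: inOX ].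

(** The cross product of two points on the line [l] is proportional to [l], and pairing with [e]
    reads off the factor. *)
Lemma det3_line (e l o x p : K * K * K) :
    dot3 e l = 1 -> dot3 l x = 0 -> dot3 l p = 0 ->
  det3 o x p = det3 e x p * dot3 o l.
Proof.
case: e l o x p => [[e0 e1] e2] [[l0 l1] l2] [[o0 o1] o2] [[x0 x1] x2] [[p0 p1] p2].
rewrite /det3 /dot3 /= => el lx lp; apply/eqP; rewrite -subr_eq0; apply/eqP.
rewrite -[X in X - _]mulr1 -[X in _ * X - _]el.
pose b0 := o1 * e2 - o2 * e1; pose b1 := o2 * e0 - o0 * e2.
pose b2 := o0 * e1 - o1 * e0.
transitivity ((b0 * p0 + b1 * p1 + b2 * p2) * (l0 * x0 + l1 * x1 + l2 * x2)
  - (b0 * x0 + b1 * x1 + b2 * x2) * (l0 * p0 + l1 * p1 + l2 * p2)).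
  by rewrite /b0 /b1 /b2; ring.
by rewrite lx lp; ring.
Qed.

(** Modulo [lam = l(r)] the point [r] lies on both the line and the cubic, so the factorisation of
    the cubic on the line makes the product of the three determinants vanish. *)
Lemma line_cuts_dvd (a4 a6 : int) (l p1 p2 p3 : int * int * int)
    (r o1 o2 o3 : K * K * K) :
    line_cuts a4 a6 l p1 p2 p3 -> weierstrass a4 a6 r = 0 ->
    inO3 r -> inO3 o1 -> inO3 o2 -> inO3 o3 ->
  exists2 t, inO t &
    det3 o1 r (int3 p1) * det3 o2 r (int3 p2) * det3 o3 r (int3 p3)
    = dot3 (int3 l) r * t.
Proof.
move=> [e [el lp1 lp2 lp3 cut]] Fr [Or0 Or1 Or2] Oo1 Oo2 Oo3.
set lam := dot3 _ r.
(* Since e pairs to 1 with l, this point is on the line, and it agrees with [r] modulo [lam]. *)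
pose x := (r.1.1 - lam * (int3 e).1.1, r.1.2 - lam * (int3 e).1.2,
           r.2 - lam * (int3 e).2).
have lx : dot3 (int3 l) x = 0.
  transitivity (lam * (1 - dot3 (int3 e) (int3 l))); last by rewrite el subrr mulr0.
  by rewrite /x /lam /dot3 /=; ring.
have Olam : inO lam by rewrite /lam /dot3; inO_closure.
have split_det (o p : K * K * K) : dot3 (int3 l) p = 0 ->
    det3 o r p = det3 (int3 e) x p * dot3 o (int3 l) + lam * det3 o (int3 e) p.
  by move=> lp; rewrite -(det3_line _ _ o _ _ el lx lp) /det3 /x /=; ring.
have [k Ok Fx] : exists2 k, inO k & weierstrass a4 a6 x = lam * k.
  case: (e) @x {lx split_det} => [[e0 e1] e2] /=.
  (* Difference quotient of the cubic between [r], where it vanishes, and [x = r - lam e]. *)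
  exists (- ((e0%:~R) * (3 * r.1.1 ^+ 2 + - (3 * r.1.1 * lam * e0%:~R) + lam ^+ 2 * e0%:~R ^+ 2)
    + a4%:~R * (r.1.1 * e2%:~R * (2 * r.2 + - (lam * e2%:~R))
       + e0%:~R * (r.2 + - (lam * e2%:~R)) ^+ 2)
    + a6%:~R * e2%:~R * (3 * r.2 ^+ 2 + - (3 * r.2 * lam * e2%:~R) + lam ^+ 2 * e2%:~R ^+ 2)
    + - (e1%:~R * (2 * r.1.2 + - (lam * e1%:~R)) * r.2
       + (r.1.2 + - (lam * e1%:~R)) ^+ 2 * e2%:~R))).
    by inO_closure.
  by rewrite -[LHS]subr0 -Fr /weierstrass /=; ring.
have Ox : inO3 x by split; rewrite /x /=; inO_closure.
have Odet (o p : K * K * K) (q : int * int * int) :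
    inO3 o -> inO3 p -> inO (det3 o p (int3 q)).
  by move=> [? ? ?] [? ? ?]; rewrite /det3 /=; inO_closure.
have Odot (o : K * K * K) : inO3 o -> inO (dot3 o (int3 l)).
  by move=> [? ? ?]; rewrite /dot3 /=; inO_closure.
have Oe : inO3 (int3 e) by split; exact: inO_int.
(* Telescoping: the three factors from [split_det] are replaced one at a time, each replacement
   costing a multiple of [lam]. *)
exists (k * dot3 o1 (int3 l) * dot3 o2 (int3 l) * dot3 o3 (int3 l)
  + det3 o1 (int3 e) (int3 p1) * det3 o2 r (int3 p2) * det3 o3 r (int3 p3)
  + det3 (int3 e) x (int3 p1) * dot3 o1 (int3 l)
    * det3 o2 (int3 e) (int3 p2) * det3 o3 r (int3 p3)
  + det3 (int3 e) x (int3 p1) * dot3 o1 (int3 l)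
    * (det3 (int3 e) x (int3 p2) * dot3 o2 (int3 l)) * det3 o3 (int3 e) (int3 p3)).
  by do !(apply: inLD); do !(apply: inOM) => //; by [apply: Odet | apply: Odot].
have kE : lam * k = _ := etrans (esym Fx) (cut _ lx).
rewrite !split_det //; move: kE.
set D1 := det3 _ x _; set D2 := det3 _ x _; set D3 := det3 _ x _ => kE.
by ring: kE.
Qed.

(** * The ideal of minors at the point R, where d = v d' *)

Section Specialization.

Context (a4 a6 u v : int).
Hypothesis dE_eq : d = dE a4 a6 u v.
Let d' := u ^+ 3 + a4 * u * v ^+ 2 - a6 * v ^+ 3.
Hypotheses (v_gt0 : 0 < v) (cop_vd' : coprimez v d').

(* The point (-u/v, w/v^2) of the curve over Q(w) *)
Definition twist_pt : K * K * K := (- (u * v)%:~R, w, (v ^+ 2)%:~R).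

(** The point (A/C^2 : B/C^3 : 1) cleared of denominators; (1, 1, 0) gives the point at infinity (0
    : 1 : 0). *)
Definition proj_coord (A B C : int) : int * int * int := (A * C, B, C ^+ 3).

(** The extra factor [v] comes from using two proportional integral representatives of R: one shows
    that v times the product is a multiple of v l(R), the other that d' times it is, and v is prime
    to d'. *)
Lemma line_cuts_twist_dvd (l p1 p2 p3 : int * int * int) (o1 o2 o3 : K * K * K) :
    line_cuts a4 a6 l p1 p2 p3 -> inO3 o1 -> inO3 o2 -> inO3 o3 ->
  exists2 t, inO t &
    det3 o1 twist_pt (int3 p1) * det3 o2 twist_pt (int3 p2)
      * det3 o3 twist_pt (int3 p3) = v%:~R * dot3 (int3 l) twist_pt * t.
Proof.
move=> cut Oo1 Oo2 Oo3.
have w2E : w ^+ 2 = - (v * d')%:~R by rewrite w2 dE_eq.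
have w0 : w != 0 by rewrite -sqrf_eq0 w2 oppr_eq0 intr_eq0; rewrite gt_eqF.
have v0 : (v%:~R : K) != 0 by rewrite intr_eq0 gt_eqF.
have [t Ot tE] : exists2 t, inO t & det3 o1 twist_pt (int3 p1)
    * det3 o2 twist_pt (int3 p2) * det3 o3 twist_pt (int3 p3)
    = dot3 (int3 l) twist_pt * t.
  apply: line_cuts_dvd cut _ _ _ _ _ => //; last first.
    by split; rewrite /= -?rmorphN; [exact: inO_int | exact: inO_w | exact: inO_int].
  by rewrite /weierstrass /= w2E /d'; ring.
(* [w / v] times the same point is integral too, and locally primitive at [v]. *)
pose r : K * K * K := (- u%:~R * w, - d'%:~R, v%:~R * w).
have [t' Ot' tE'] : exists2 t, inO t & det3 o1 r (int3 p1)
    * det3 o2 r (int3 p2) * det3 o3 r (int3 p3) = dot3 (int3 l) r * t.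
  apply: line_cuts_dvd cut _ _ _ _ _ => //; last first.
    by split; rewrite /= -?rmorphN; inO_closure.
  rewrite /weierstrass /= (_ : _ - _ = w * (w ^+ 2 * - d'%:~R - v%:~R * d'%:~R ^+ 2)).
    by rewrite w2E; ring.
  by rewrite /d'; ring.
have rE (o p : K * K * K) : v%:~R * det3 o r p = w * det3 o twist_pt p.
  by rewrite /det3 /=; ring: w2E.
have lE : v%:~R * dot3 (int3 l) r = w * dot3 (int3 l) twist_pt.
  by rewrite /dot3 /=; ring: w2E.
have [[p q] /= pq] := coprimezP _ _ cop_vd'.
set X := _ * _ * _ in tE *; set lam := dot3 _ _ in tE lE *.
have key : d'%:~R * X = - (v%:~R * lam * t').
  apply: (mulfI v0); apply: (mulfI w0).
  transitivity (- (w ^+ 3 * X)); first by rewrite exprS w2E; ring.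
  transitivity (- (v%:~R ^+ 2 * (v%:~R * dot3 (int3 l) r) * t')); last by rewrite lE; ring.
  have -> : w ^+ 3 * X = (w * det3 o1 twist_pt (int3 p1))
     * (w * det3 o2 twist_pt (int3 p2)) * (w * det3 o3 twist_pt (int3 p3)).
    by rewrite /X; ring.
  rewrite -!rE; transitivity (- (v%:~R ^+ 3 * (det3 o1 r (int3 p1)
    * det3 o2 r (int3 p2) * det3 o3 r (int3 p3)))); first by ring.
  by rewrite tE'; ring.
exists (p%:~R * t + - (q%:~R * t')); first by inO_closure.
transitivity ((p * v + q * d')%:~R * X); first by rewrite pq mul1r.
by rewrite intrD !intrM mulrDl -[q%:~R * _ * X]mulrA key -mulrA tE; ring.
Qed.

(* [g] is gcd(C, v) and [mu] inverts C^3 / g^2 modulo [m = v a / g^2]. *)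
Definition Phi_data (A B C g m h : int) : Prop :=
  exists v' c' mu s : int,
    [/\ [/\ v = g * v', C = g * c', 0 < g & coprimez g v'],
        m = v' * (A * v' + g * c' ^+ 2 * u),
        mu * (g * c' ^+ 3) + s * m = 1 & h = mu * (B * v' ^+ 2)].

Lemma Phi_data_opp (A B C g m h : int) :
  Phi_data A B C g m h -> Phi_data A (- B) C g m (- h).
Proof.
by move=> [v' [c' [mu [s [? ? ? ->]]]]]; exists v', c', mu, s; split=> //; ring.
Qed.

(** Both g (g z) and n (g z) are shown to lie in the ideal [M] of minors, for an integer n prime to
    g; hence g z does. *)
Lemma Phi_data_inL (A B C g m h : int) (z : K) :
    coprimez B C -> Phi_data A B C g m h -> inL m h z ->
  exists2 o, inO3 o & g%:~R * z = det3 o twist_pt (int3 (proj_coord A B C)).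
Proof.
move=> copBC [v' [c' [mu [s [[vE CE g_gt0 copgv'] mE musE hE]]]]] Lz.
pose M (x : K) := exists2 o, inO3 o & x = det3 o twist_pt (int3 (proj_coord A B C)).
have MD (x y : K) : M x -> M y -> M (x + y).
  move=> [o [? ? ?] ->] [o' [? ? ?] ->].
  exists (o.1.1 + o'.1.1, o.1.2 + o'.1.2, o.2 + o'.2); last by rewrite /det3 /=; ring.
  by split; exact: inLD.
have MM (x y : K) : inO x -> M y -> M (x * y).
  move=> Ox [o [? ? ?] ->].
  exists (x * o.1.1, x * o.1.2, x * o.2); last by rewrite /det3 /=; ring.
  by split; exact: inOM.
have O0 := inO_int 0; have O1 := inO_int 1.
have M0 : M ((C ^+ 3)%:~R * w - (B * v ^+ 2)%:~R).
  by exists (1, 0, 0) => //; rewrite /det3 /=; ring.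
have M1 : M (C * (v * (A * v + C ^+ 2 * u)))%:~R.
  by exists (0, 1, 0) => //; rewrite /det3 /=; ring.
have M2 : M (- (u * v * B)%:~R - (A * C)%:~R * w).
  by exists (0, 0, 1) => //; rewrite /det3 /=; ring.
have Mva : M (v * (A * v + C ^+ 2 * u))%:~R.
  (* The ideal contains v a C as a minor and v a B as a combination of the other two, where a = A v
     + C^2 u; as B and C are coprime it contains v a. *)
  have [[p q] /= pq] := coprimezP _ _ copBC.
  have -> : (v * (A * v + C ^+ 2 * u))%:~R = (- p * A)%:~R * ((C ^+ 3)%:~R * w - (B * v ^+ 2)%:~R)
    + ((- p * C ^+ 2)%:~R * (- (u * v * B)%:~R - (A * C)%:~R * w)
    + q%:~R * (C * (v * (A * v + C ^+ 2 * u)))%:~R) :> K.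
    transitivity ((p * B + q * C)%:~R * (v * (A * v + C ^+ 2 * u))%:~R : K).
      by rewrite pq mul1r.
    by ring.
  by apply: (MD); [|apply: (MD)]; apply: (MM) => //; exact: inO_int.
have Mg2m : M (g ^+ 2 * m)%:~R.
  by move: Mva; rewrite mE vE CE; congr M; ring.
have Mg2z : M (g%:~R * (g%:~R * z)).
  case: Lz => [x [y ->]].
  (* Since mu C^3 is g^2 modulo g^2 m, the generator g^2 (h - w) is -mu times the minor [M0], up to
     a multiple of g^2 m. *)
  have -> : g%:~R * (g%:~R * (x%:~R * m%:~R + y%:~R * (h%:~R - w)))
    = (x%:~R - (y * s)%:~R * w) * (g ^+ 2 * m)%:~R
      + (- (y * mu))%:~R * ((C ^+ 3)%:~R * w - (B * v ^+ 2)%:~R).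
    rewrite hE vE CE.
    transitivity (g%:~R * (g%:~R * (x%:~R * m%:~R + y%:~R * ((mu * (B * v' ^+ 2))%:~R
      - (mu * (g * c' ^+ 3) + s * m)%:~R * w)))); first by rewrite musE mul1r.
    by ring.
  apply: MD; apply: MM => //; last exact: inO_int.
  by rewrite -mulNr -rmorphN; exact: inOP.
(* The third minor is [- g * eta] with [eta] of norm [n], prime to [g]. *)
pose n := (u * v' * B) ^+ 2 + d * (A * c') ^+ 2.
have copn : coprimez g n.
  (* A common divisor of g and u divides both v and d'. *)
  have copgu : coprimez g u.
    have [[p q] /= pq] := coprimezP _ _ cop_vd'.
    apply/coprimezP; exists (p * v' - q * a6 * v' ^+ 3 * g ^+ 2, q * (u ^+ 2 + a4 * v ^+ 2)).
    by rewrite -pq /d' vE /=; ring.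
  have copgB : coprimez g B.
    by move: copBC; rewrite CE coprimezMr coprimez_sym => /andP[].
  have : coprimez g ((u * v' * B) ^+ 2).
    by rewrite coprimezXr // !coprimezMr copgu copgv' copgB.
  move=> /coprimezP[[p q] /= pq]; apply/coprimezP.
  exists (p - q * v' * d' * (A * c') ^+ 2, q) => /=.
  have dgE : d = g * v' * d' by rewrite -vE.
  by rewrite -pq /n dgE; ring.
have Mgnz : M (n%:~R * (g%:~R * z)).
  have -> : n%:~R * (g%:~R * z) = (- ((u * v' * B)%:~R - (A * c')%:~R * w) * z)
     * (- (u * v * B)%:~R - (A * C)%:~R * w).
    by rewrite /n vE CE; ring: w2.
  apply: MM => //; apply: inOM.
    by apply: inON; rewrite -mulNr -rmorphN; exact: inOP.
  by case: Lz => [x [y ->]]; inO_closure; rewrite -mulN1r; inO_closure; exact: (inO_int (-1)).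
have [[p q] /= pq] := coprimezP _ _ copn.
have -> : g%:~R * z = p%:~R * (g%:~R * (g%:~R * z)) + q%:~R * (n%:~R * (g%:~R * z)).
  transitivity ((p * g + q * n)%:~R * (g%:~R * z)); first by rewrite pq mul1r.
  by ring.
by apply: MD; apply: MM => //; exact: inO_int.
Qed.

Lemma Phi_data_norm (A B C g m h : int) :
  Phi_data A B C g m h -> g ^+ 2 * m = v * (A * v + C ^+ 2 * u).
Proof. by move=> [v' [c' [mu [s [[-> -> _ _] -> _ _]]]]]; ring. Qed.

Lemma Phi_data_gt0 (A B C g m h : int) : Phi_data A B C g m h -> 0 < g.
Proof. by move=> [v' [c' [mu [s [[]]]]]]. Qed.

Lemma line_cuts_product (l : int * int * int) (A1 B1 C1 g1 m1 h1
    A2 B2 C2 g2 m2 h2 A3 B3 C3 g3 m3 h3 : int) :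
    coprimez B1 C1 -> coprimez B2 C2 -> coprimez B3 C3 ->
    Phi_data A1 B1 C1 g1 m1 h1 -> Phi_data A2 B2 C2 g2 m2 h2 ->
    Phi_data A3 B3 C3 g3 m3 h3 ->
    line_cuts a4 a6 l (proj_coord A1 B1 C1) (proj_coord A2 B2 C2)
      (proj_coord A3 B3 C3) ->
    dot3 (int3 l) twist_pt * (dot3 (int3 l) twist_pt)^*
    = (v * ((A1 * v + C1 ^+ 2 * u) * (A2 * v + C2 ^+ 2 * u)
            * (A3 * v + C3 ^+ 2 * u)))%:~R ->
  exists2 b, b * b^* = (m1 * m2 * m3)%:~R &
    forall x y z, inL m1 h1 x -> inL m2 h2 y -> inL m3 h3 z ->
      exists2 t, inO t & x * y * z = b * t.
Proof.
move=> cop1 cop2 cop3 D1 D2 D3 cut.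
set lam := dot3 _ _ => Nlam.
have gK (A B C g m h : int) : Phi_data A B C g m h -> (g%:~R : K) != 0.
  by move=> /Phi_data_gt0 g0; rewrite intr_eq0 gt_eqF.
have [[g10 g20] g30] := (gK _ _ _ _ _ _ D1, gK _ _ _ _ _ _ D2, gK _ _ _ _ _ _ D3).
(* The product of the minors is divisible by v l(R), and each lattice element enters scaled by its
   g; the norm follows from g^2 m = v a at each point. *)
exists (v%:~R * lam / (g1 * g2 * g3)%:~R).
  have -> : (v%:~R * lam / (g1 * g2 * g3)%:~R)^* = v%:~R * lam^* / (g1 * g2 * g3)%:~R.
    by rewrite [LHS]rmorphM /= fmorphV [(v%:~R * lam)^*]rmorphM /= !conj_int.
  have -> : v%:~R * lam / (g1 * g2 * g3)%:~R * (v%:~R * lam^* / (g1 * g2 * g3)%:~R)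
    = v%:~R ^+ 2 * (lam * lam^* ) / (g1 * g2 * g3)%:~R ^+ 2.
    by field; rewrite g10 g20 g30.
  have -> : v%:~R ^+ 2 * (lam * lam^* ) = ((g1 ^+ 2 * m1) * (g2 ^+ 2 * m2) * (g3 ^+ 2 * m3))%:~R.
    rewrite (Phi_data_norm _ _ _ _ _ _ D1) (Phi_data_norm _ _ _ _ _ _ D2).
    by rewrite (Phi_data_norm _ _ _ _ _ _ D3) Nlam; ring.
  by field; rewrite g10 g20 g30.
move=> x y z Lx Ly Lz.
have [o1 Oo1 xE] := Phi_data_inL _ _ _ _ _ _ _ cop1 D1 Lx.
have [o2 Oo2 yE] := Phi_data_inL _ _ _ _ _ _ _ cop2 D2 Ly.
have [o3 Oo3 zE] := Phi_data_inL _ _ _ _ _ _ _ cop3 D3 Lz.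
have [t Ot tE] := line_cuts_twist_dvd _ _ _ _ _ _ _ cut Oo1 Oo2 Oo3.
exists t => //; rewrite -xE -yE -zE -/lam in tE.
apply: (mulfI g10); apply: (mulfI g20); apply: (mulfI g30).
transitivity (v%:~R * lam * t); first by rewrite -tE; ring.
by field; rewrite g10 g20 g30.
Qed.

(** * Vertical lines, the line at infinity, and chords *)

Lemma line_cuts_perm (l p1 p2 p3 : int * int * int) :
  line_cuts a4 a6 l p1 p2 p3 -> line_cuts a4 a6 l p3 p1 p2.
Proof.
move=> [e [? ? ? ? cut]]; exists e; split=> // x lx; rewrite (cut _ lx); ring.
Qed.

Lemma vertical_line_cuts (A B C : int) :
    coprimez A C -> B ^+ 2 = A ^+ 3 + a4 * A * C ^+ 4 + a6 * C ^+ 6 ->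
  line_cuts a4 a6 (C ^+ 2, 0, - A) (proj_coord A B C) (proj_coord A (- B) C)
    (proj_coord 1 1 0).
Proof.
move=> copAC curve.
have : coprimez A (C ^+ 2) by apply: coprimezXr.
move=> /coprimezP[[q p] /= pq].
exists (p, 0, - q); split; rewrite /dot3 /=.
- transitivity ((q * A + p * C ^+ 2)%:~R : K); last by rewrite pq.
  by ring.
- by ring.
- by ring.
- by ring.
move=> [[x y] z] /= lx.
(* Parameter on the line: its points are (A s, y, C^2 s), where the cubic becomes s (B^2 s^2 - C^2
   y^2). *)
pose s := p%:~R * z + q%:~R * x.
have pqK : q%:~R * A%:~R + p%:~R * C%:~R ^+ 2 = 1 :> K.
  by rewrite -[RHS](congr1 (fun n : int => n%:~R) pq); ring.
have lx' : A%:~R * z = C%:~R ^+ 2 * x.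
  by apply/eqP; rewrite -subr_eq0 -oppr_eq0 -lx; apply/eqP; ring.
have xE : x = A%:~R * s.
  transitivity (q%:~R * A%:~R * x + p%:~R * (C%:~R ^+ 2 * x)).
    transitivity ((q%:~R * A%:~R + p%:~R * C%:~R ^+ 2) * x); last by ring.
    by rewrite pqK mul1r.
  by rewrite -lx' /s; ring.
have zE : z = C%:~R ^+ 2 * s.
  transitivity (q%:~R * (A%:~R * z) + p%:~R * C%:~R ^+ 2 * z).
    transitivity ((q%:~R * A%:~R + p%:~R * C%:~R ^+ 2) * z); last by ring.
    by rewrite pqK mul1r.
  by rewrite lx' /s; ring.
have curveK : A%:~R ^+ 3 = B%:~R ^+ 2 - a4%:~R * A%:~R * C%:~R ^+ 4 - a6%:~R * C%:~R ^+ 6 :> K.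
  have -> : B%:~R ^+ 2 = (B ^+ 2)%:~R :> K by ring.
  by rewrite curve; ring.
have dE1 (n : int) : det3 (p%:~R, 0, (- q)%:~R) (x, y, z) ((A * C)%:~R, n%:~R, (C ^+ 3)%:~R)
    = y * C%:~R - s * n%:~R.
  rewrite /det3 /= xE zE.
  transitivity ((q%:~R * A%:~R + p%:~R * C%:~R ^+ 2) * (y * C%:~R - s * n%:~R)).
    by ring.
  by rewrite pqK mul1r.
have dE2 : det3 (p%:~R, 0, (- q)%:~R) (x, y, z) (int3 (proj_coord 1 1 0)) = - s.
  by rewrite /det3 /s /=; ring.
by rewrite /int3 !dE1 dE2 /weierstrass /= xE zE; ring: curveK.
Qed.

Lemma vertical_line_norm (A C : int) :
  dot3 (int3 (C ^+ 2, 0, - A)) twist_pt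
    * (dot3 (int3 (C ^+ 2, 0, - A)) twist_pt)^*
  = (v * ((A * v + C ^+ 2 * u) * (A * v + C ^+ 2 * u) * (1 * v + 0 ^+ 2 * u)))%:~R.
Proof.
have -> : dot3 (int3 (C ^+ 2, 0, - A)) twist_pt = (- (v * (A * v + C ^+ 2 * u)))%:~R.
  by rewrite /dot3 /=; ring.
by rewrite conj_int; ring.
Qed.

(** The point at infinity is a flex: on z = 0 the cubic restricts to x^3. *)
Lemma infinity_line_cuts :
  line_cuts a4 a6 (0, 0, 1) (proj_coord 1 1 0) (proj_coord 1 1 0) (proj_coord 1 1 0).
Proof.
exists (0, 0, 1); split; rewrite /dot3 /=; try ring.
move=> [[x y] z] /= lx; have -> : z = 0 by rewrite -lx; ring.
by rewrite /weierstrass /det3 /=; ring.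
Qed.

Lemma infinity_line_norm :
  dot3 (int3 (0, 0, 1)) twist_pt * (dot3 (int3 (0, 0, 1)) twist_pt)^*
  = (v * ((1 * v + 0 ^+ 2 * u) * (1 * v + 0 ^+ 2 * u) * (1 * v + 0 ^+ 2 * u)))%:~R.
Proof.
have -> : dot3 (int3 (0, 0, 1)) twist_pt = (v ^+ 2)%:~R by rewrite /dot3 /=; ring.
by rewrite conj_int; ring.
Qed.

(** The last three hypotheses compare coefficients in T^2 (x^3 + a4 x + a6) - (L x + N)^2 = product
    of the C_i^2 x - A_i. Homogenised, this is the factorisation on the line; at x = -u/v,
    multiplied by -v^4, it is the norm of l(R). *)
Lemma chord_line_cuts (A1 B1 C1 A2 B2 C2 A3 B3 C3 L N : int) :
    let T := C1 * C2 * C3 in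
    (exists e0 e1 e2 : int, e0 * L + e1 * T + e2 * N = 1) ->
    0 < C1 -> 0 < C2 -> 0 < C3 ->
    T * B1 = (L * A1 + N * C1 ^+ 2) * C1 -> T * B2 = (L * A2 + N * C2 ^+ 2) * C2 ->
    T * B3 = (L * A3 + N * C3 ^+ 2) * C3 ->
    L ^+ 2 = A1 * C2 ^+ 2 * C3 ^+ 2 + C1 ^+ 2 * A2 * C3 ^+ 2 + C1 ^+ 2 * C2 ^+ 2 * A3 ->
    a4 * T ^+ 2 - 2 * L * N
    = A1 * A2 * C3 ^+ 2 + A1 * C2 ^+ 2 * A3 + C1 ^+ 2 * A2 * A3 ->
    N ^+ 2 - a6 * T ^+ 2 = A1 * A2 * A3 ->
  line_cuts a4 a6 (L, - T, N) (proj_coord A1 B1 C1) (proj_coord A2 B2 C2)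
    (proj_coord A3 B3 C3) /\
  dot3 (int3 (L, - T, N)) twist_pt * (dot3 (int3 (L, - T, N)) twist_pt)^*
    = (v * ((A1 * v + C1 ^+ 2 * u) * (A2 * v + C2 ^+ 2 * u)
            * (A3 * v + C3 ^+ 2 * u)))%:~R.
Proof.
move=> T [e0 [e1 [e2 bez]]] C1_gt0 C2_gt0 C3_gt0 P1 P2 P3 q2 q1 q0.
have T_gt0 : 0 < T by rewrite !mulr_gt0.
have TK : (T%:~R : K) != 0 by rewrite intr_eq0 gt_eqF.
split; last first.
  have -> : dot3 (int3 (L, - T, N)) twist_pt = (N * v ^+ 2 - L * u * v)%:~R - T%:~R * w.
    by rewrite /dot3 /=; ring.
  have -> : ((N * v ^+ 2 - L * u * v)%:~R - T%:~R * w)^*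
      = (N * v ^+ 2 - L * u * v)%:~R + T%:~R * w.
    by rewrite [LHS]rmorphB /= [(T%:~R * w)^*]rmorphM /= !conj_int conj_w mulrN opprK.
  transitivity ((T ^+ 2 * d + v ^+ 2 * (L * u - N * v) ^+ 2)%:~R : K).
    by ring: w2.
  apply: (congr1 (fun n : int => n%:~R)); rewrite dE_eq /dE.
  transitivity (v * (T ^+ 2 * u ^+ 3 + L ^+ 2 * u ^+ 2 * v
     + (a4 * T ^+ 2 - 2 * L * N) * u * v ^+ 2 + (N ^+ 2 - a6 * T ^+ 2) * v ^+ 3)).
    by ring.
  by rewrite q2 q1 q0 /T; ring.
have on_line (A B C : int) : T * B = (L * A + N * C ^+ 2) * C ->
    dot3 (int3 (L, - T, N)) (int3 (proj_coord A B C)) = 0.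
  move=> e; transitivity (((L * A + N * C ^+ 2) * C - T * B)%:~R : K).
    by rewrite /dot3 /=; ring.
  by rewrite e subrr.
have el : dot3 (int3 (e0, - e1, e2)) (int3 (L, - T, N)) = 1.
  by transitivity ((e0 * L + e1 * T + e2 * N)%:~R : K);
    [rewrite /dot3 /=; ring | rewrite bez].
exists (e0, - e1, e2); split=> //; try exact: on_line.
move=> x lx.
(* Testing against the vector (0, 1, 0), which pairs with the line to -T, eliminates the y
   coordinate. *)
have Tdet (A B C : int) : T * B = (L * A + N * C ^+ 2) * C ->
    T%:~R * det3 (int3 (e0, - e1, e2)) x (int3 (proj_coord A B C))
    = C%:~R * (C%:~R ^+ 2 * x.1.1 - A%:~R * x.2).
  move=> /on_line lp; have := det3_line _ _ (0, 1, 0) _ _ el lx lp.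
  rewrite {1}/det3 /dot3 /= => h; apply: oppr_inj.
  transitivity (det3 (int3 (e0, - e1, e2)) x (int3 (proj_coord A B C))
    * (0 * L%:~R + 1 * (- T)%:~R + 0 * N%:~R)); first by ring.
  by rewrite -h; ring.
have Tx1 : T%:~R * x.1.2 = L%:~R * x.1.1 + N%:~R * x.2.
  apply/eqP; rewrite -subr_eq0 -oppr_eq0 -lx /dot3 /=; apply/eqP; ring.
apply: (mulfI TK); apply: (mulfI TK); apply: (mulfI TK).
transitivity ((T%:~R * det3 (int3 (e0, - e1, e2)) x (int3 (proj_coord A1 B1 C1)))
  * (T%:~R * det3 (int3 (e0, - e1, e2)) x (int3 (proj_coord A2 B2 C2)))
  * (T%:~R * det3 (int3 (e0, - e1, e2)) x (int3 (proj_coord A3 B3 C3)))); last by ring.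
rewrite !Tdet //.
transitivity (T%:~R * (T%:~R ^+ 2 * x.1.1 ^+ 3 + T%:~R ^+ 2 * a4%:~R * x.1.1 * x.2 ^+ 2
   + T%:~R ^+ 2 * a6%:~R * x.2 ^+ 3 - (T%:~R * x.1.2) ^+ 2 * x.2)).
  by rewrite /weierstrass; ring.
rewrite Tx1.
transitivity (T%:~R * (T%:~R ^+ 2 * x.1.1 ^+ 3 - (L ^+ 2)%:~R * x.1.1 ^+ 2 * x.2
  + (a4 * T ^+ 2 - 2 * L * N)%:~R * x.1.1 * x.2 ^+ 2
  - (N ^+ 2 - a6 * T ^+ 2)%:~R * x.2 ^+ 3)); first by ring.
by rewrite q2 q1 q0 /T; ring.
Qed.

End Specialization.

End QuadraticLattice.

(** * Arithmetic of the discriminant and of the coordinates *)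

Lemma coprimez_no_prime (m n : int) :
  (forall p : nat, prime p -> (p %| m)%Z -> (p %| n)%Z -> False) -> coprimez m n.
Proof.
move=> pP; apply: contraT => mn; exfalso.
have [g1|g1] := leqP (gcdn `|m| `|n|) 1.
  (* Both integers vanish here, so the prime 2 divides them. *)
  have mn0 : (gcdn `|m| `|n| = 0)%N.
    by move: mn g1; rewrite coprimezE /coprime; case: gcdn => [|[]].
  apply: (pP 2) => //; rewrite dvdzE; first by
    have := dvdn_gcdl `|m| `|n|; rewrite mn0 dvd0n => /eqP->.
  by have := dvdn_gcdr `|m| `|n|; rewrite mn0 dvd0n => /eqP->.
apply: (pP (pdiv (gcdn `|m| `|n|))); rewrite ?pdiv_prime // dvdzE.
  exact: dvdn_trans (pdiv_dvd _) (dvdn_gcdl _ _).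
exact: dvdn_trans (pdiv_dvd _) (dvdn_gcdr _ _).
Qed.

Lemma prime_dvdzX (p : nat) (x : int) (k : nat) :
  prime p -> (p %| x ^+ k)%Z -> (p %| x)%Z.
Proof. by move=> pp; rewrite !dvdzE abszX Euclid_dvdX // => /andP[]. Qed.

Lemma prime_dvdzM (p : nat) (x y : int) :
  prime p -> (p %| x * y)%Z = (p %| x)%Z || (p %| y)%Z.
Proof. by move=> pp; rewrite !dvdzE abszM Euclid_dvdM. Qed.

Lemma squarefree_coprime (x y n : int) :
  squarefree_int n -> (x * y %| n)%Z -> coprimez x y.
Proof.
move=> sqf xy; apply: coprimez_no_prime => p pp px py.
have /negP := sqf p pp; apply.
have : (p%:Z * p%:Z %| n)%Z by apply: dvdz_trans xy; apply: dvdz_mul.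
by rewrite dvdzE abszM.
Qed.

Lemma fundamental_disc_4 (d : int) : fundamental_disc (- (4 * d)) ->
  squarefree_int d /\ ((d %% 4)%Z = 1 \/ (d %% 4)%Z = 2).
Proof.
have -> : - (4 * d) = (- d) * 4 by ring.
rewrite /fundamental_disc mulzK // modzMl => -[[]|[_ [d4 sqf]]] //.
split; last by move: d4; clear; lia.
by move=> p /sqf; rewrite abszN.
Qed.

(** Let a prime p divide m, 2h and c. If p divides h, then p^2 divides d; otherwise p = 2 with h
    odd, and d = m c - h^2 is 3 modulo 4. *)
Lemma fundamental_primitive (d m h c : int) :
    squarefree_int d -> (d %% 4)%Z = 1 \/ (d %% 4)%Z = 2 ->
    h ^+ 2 + d = m * c -> primitive_form m (2 * h) c.
Proof.
move=> sqf d4 e.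
suff : coprimez (gcdz m (2 * h)) c.
  have [x [y xy]] := Bezoutz m (2 * h); rewrite -xy => /coprimezP[[p q] /= pq].
  by exists (p * x), (p * y), q; rewrite -[RHS]pq; ring.
apply: coprimez_no_prime => p pp; rewrite dvdz_gcd => /andP[pm ph] pc.
have /dvdzP[m' mE] := pm; have /dvdzP[c' cE] := pc.
have [/dvdzP[h' hE]|nph] := boolP (p %| h)%Z.
  have : (p%:Z * p%:Z %| d)%Z.
    apply/dvdzP; exists (m' * c' - h' ^+ 2).
    transitivity (m * c - h ^+ 2); first by rewrite -e; ring.
    by rewrite mE cE hE; ring.
  by rewrite dvdzE abszM; apply/negP; exact: sqf.
move: ph; rewrite prime_dvdzM // (negbTE nph) orbF dvdzE => p2.
have {}p2 : p = 2 by apply/eqP; rewrite -dvdn_prime2.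
move: nph; rewrite p2 => nph.
have hE : h = 2 * (h %/ 2)%Z + 1 by move: nph; clear; lia.
have dE : d = 4 * (m' * c' - (h %/ 2)%Z ^+ 2 - (h %/ 2)%Z) - 1.
  transitivity (m * c - h ^+ 2); first by rewrite -e; ring.
  by rewrite mE cE {1}hE p2; ring.
by move: (_ - _ - _) dE d4 => k; clear; lia.
Qed.

(** Clearing denominators shows that denq(y)^2 and denq(x)^3 divide each other. They are thus equal,
    so denq(x) divides denq(y), and the quotient C has square denq(x). *)
Lemma curve_denominators (a4 a6 : int) (x y : rat) (C := (denq y %/ denq x)%Z) :
    y ^+ 2 = x ^+ 3 + a4%:~R * x + a6%:~R ->
  [/\ 0 < C, denq x = C ^+ 2, denq y = C ^+ 3
    & numq y ^+ 2 = numq x ^+ 3 + a4 * numq x * C ^+ 4 + a6 * C ^+ 6].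
Proof.
rewrite {}/C => curve.
have copx : coprimez (numq x) (denq x) by rewrite coprimezE coprime_num_den.
have copy : coprimez (numq y) (denq y) by rewrite coprimezE coprime_num_den.
have := denq_gt0 x; have := denq_gt0 y.
have xE : x = (numq x)%:~R / (denq x)%:~R by rewrite divq_num_den.
have yE : y = (numq y)%:~R / (denq y)%:~R by rewrite divq_num_den.
move: (numq x) (denq x) (numq y) (denq y) xE yE copx copy => n D e f xE yE copx copy f0 D0.
have DK : (D%:~R : rat) != 0 by rewrite intr_eq0 gt_eqF.
have fK : (f%:~R : rat) != 0 by rewrite intr_eq0 gt_eqF.
have eq1 : e ^+ 2 * D ^+ 3 = (n ^+ 3 + a4 * n * D ^+ 2 + a6 * D ^+ 3) * f ^+ 2.
  apply: (@intr_inj rat).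
  transitivity (y ^+ 2 * f%:~R ^+ 2 * D%:~R ^+ 3); first by rewrite yE; field.
  by rewrite curve xE; field.
have eq2 : f ^+ 2 = D ^+ 3.
  apply/eqP; rewrite -[f ^+ 2]ger0_norm ?exprn_ge0 1?ltW //.
  rewrite -[D ^+ 3]ger0_norm ?exprn_ge0 1?ltW // -!abszE eqz_nat.
  rewrite eqn_dvd -!dvdzE; apply/andP; split.
    have : (f ^+ 2 %| e ^+ 2 * D ^+ 3)%Z by rewrite eq1 dvdz_mull.
    by rewrite Gauss_dvdzr // coprimezXl // coprimezXr // coprimez_sym.
  have : (D ^+ 3 %| (n ^+ 3 + a4 * n * D ^+ 2 + a6 * D ^+ 3) * f ^+ 2)%Z.
    by rewrite -eq1 dvdz_mull.
  rewrite Gauss_dvdzr //; apply: coprimezXl.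
  have : coprimez D (n ^+ 3) by apply: coprimezXr; rewrite coprimez_sym.
  move=> /coprimezP[[p q] /= pq]; apply/coprimezP.
  by exists (p - q * (a4 * n * D + a6 * D ^+ 2), q); rewrite -pq /=; ring.
have Df : (D %| f)%Z.
  rewrite -(@dvdz_pexp2r _ _ 2) // eq2; apply/dvdzP; exists D; ring.
have /dvdzP[C CE] := Df; rewrite !CE mulzK ?gt_eqF //.
have C2 : D = C ^+ 2.
  have D20 : D ^+ 2 != 0 by rewrite expf_eq0 gt_eqF.
  by apply: (mulfI D20); rewrite -exprSr -eq2 CE; ring.
split=> //.
- by move: f0; rewrite CE pmulr_lgt0.
- by rewrite C2; ring.
have D30 : D ^+ 3 != 0 by rewrite expf_eq0 gt_eqF.
apply: (mulIf D30); rewrite eq1 eq2 C2; ring.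
Qed.

(** * Rational points in integral coordinates and their forms *)

Definition ec_opp (P : ptQ) : ptQ := if P is Some (x, y) then Some (x, - y) else None.

(* [(A, B, C)] with P = (A/C^2, B/C^3), and (1, 1, 0) at infinity. *)
Definition ec_coord (P : ptQ) : int * int * int :=
  if P is Some (x, y) then (numq x, numq y, (denq y %/ denq x)%Z) else (1, 1, 0).

Lemma ec_coord_SomeP (a4 a6 : int) (x y : rat) (A := numq x) (B := numq y)
    (C := (denq y %/ denq x)%Z) : on_curve a4 a6 (Some (x, y)) ->
  [/\ 0 < C, x = A%:~R / C%:~R ^+ 2 & y = B%:~R / C%:~R ^+ 3] /\
  [/\ coprimez A C, coprimez B C
    & B ^+ 2 = A ^+ 3 + a4 * A * C ^+ 4 + a6 * C ^+ 6].
Proof.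
move=> /eqP curve; have [C0 xE yE curveZ] := curve_denominators _ _ _ _ curve.
rewrite -/C in C0 xE yE curveZ; split.
  by split; rewrite // -?rmorphXn /= -?xE -?yE divq_num_den.
split=> //.
  have : coprimez A (denq x) by rewrite coprimezE coprime_num_den.
  by rewrite xE coprimez_pexpr.
have : coprimez B (denq y) by rewrite coprimezE coprime_num_den.
by rewrite yE coprimez_pexpr.
Qed.

Lemma ec_coord_opp (x y : rat) : ec_coord (ec_opp (Some (x, y))) =
  ((ec_coord (Some (x, y))).1.1, - (ec_coord (Some (x, y))).1.2, (ec_coord (Some (x, y))).2).
Proof. by rewrite /= numqN denqN. Qed.

Lemma ec_coord_coprime (a4 a6 : int) (P : ptQ) :
  on_curve a4 a6 P -> coprimez (ec_coord P).1.2 (ec_coord P).2.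
Proof.
case: P => [[x y]|] cP; first by have [_ []] := ec_coord_SomeP _ _ _ _ cP.
by rewrite coprimezE.
Qed.

(** The positive number B^2 v^4 + C^6 d factors as v a q with a = A v + C^2 u. If a were not
    positive, q expanded in s = -a would be positive, by the condition on 3 u^2 + a4 v^2: a
    contradiction. *)
Lemma twist_coord_gt0 (a4 a6 u v A B C : int) :
    map_suitable a4 a6 u v -> C != 0 ->
    B ^+ 2 = A ^+ 3 + a4 * A * C ^+ 4 + a6 * C ^+ 6 ->
  0 < A * v + C ^+ 2 * u.
Proof.
move=> [u0 [v0 [der0]]]; rewrite /DE => D0 C0 curve.
have d0 : 0 < dE a4 a6 u v by rewrite pmulr_rgt0 in D0.
rewrite ltNge; apply/negP => a_le0.
pose q := (A * v) ^+ 2 - A * u * v * C ^+ 2 + u ^+ 2 * C ^+ 4 + a4 * v ^+ 2 * C ^+ 4.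
have eq1 : B ^+ 2 * v ^+ 4 + C ^+ 6 * dE a4 a6 u v = v * (A * v + C ^+ 2 * u) * q.
  by rewrite curve /dE /q; ring.
have pos : 0 < B ^+ 2 * v ^+ 4 + C ^+ 6 * dE a4 a6 u v.
  apply: ltr_wpDl; first by apply: mulr_ge0; apply: exprn_even_ge0.
  by apply: mulr_gt0; rewrite ?exprn_even_gt0.
have q0 : 0 < q.
  pose s := - (A * v) - C ^+ 2 * u.
  have s0 : 0 <= s by rewrite /s -opprD oppr_ge0.
  have -> : q = s ^+ 2 + 3 * s * (C ^+ 2 * u) + C ^+ 4 * (3 * u ^+ 2 + a4 * v ^+ 2).
    by rewrite /q /s; ring.
  apply: ltr_wpDl; last by apply: mulr_gt0; rewrite ?exprn_even_gt0.
  apply: addr_ge0; first exact: sqr_ge0.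
  by apply: mulr_ge0; apply: mulr_ge0 => //; [exact: sqr_ge0 | exact: ltW].
by move: pos; rewrite eq1 pmulr_lgt0 // pmulr_rgt0 // ltNge a_le0.
Qed.

(** Every integer quotient in [Phi] is exact, and the Bezout coefficient there is a true inverse
    because C^3/g^2 is prime to m. *)
Lemma Phi_dataP (a4 a6 u v : int) (P : ptQ) (d := dE a4 a6 u v) :
    map_suitable a4 a6 u v -> squarefree_int d -> on_curve a4 a6 P ->
  exists g m h c : int,
    [/\ Phi a4 a6 u v P = (m, 2 * h, c), 0 < m, h ^+ 2 + d = m * c
      & Phi_data u v (ec_coord P).1.1 (ec_coord P).1.2 (ec_coord P).2 g m h].
Proof.
move=> suit sqf; have [u0 [v0 _]] := suit.
case: P => [[x y]|] curve /=; last first.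
  (* At infinity C = 0, hence g = gcd(0, v) = v and m = 1. *)
  exists v, 1, 0, d; split=> //; first by ring.
  exists 1, 0, 0, 1; split; [split=> //; [ring | ring | by rewrite coprimezE coprimen1] | ring ..].
have [[C0 _ _] [copA copB curveZ]] := ec_coord_SomeP _ _ _ _ curve.
have a0 := twist_coord_gt0 _ _ _ _ _ _ _ suit (lt0r_neq0 C0) curveZ.
move: (numq x) (numq y) (denq y %/ denq x)%Z C0 curveZ copA copB a0 {curve}.
move=> A B C C0 curve copA copB a0.
set g := gcdz C v.
have g0 : 0 < g by rewrite lt0r gcdz_eq0 (gt_eqF v0) andbF.
have gneq0 : g != 0 by rewrite gt_eqF.
have /dvdzP[c' CE] := dvdz_gcdl C v; have /dvdzP[v' vE] := dvdz_gcdr C v.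
rewrite -/g mulrC in CE; rewrite -/g mulrC in vE.
have copcv : coprimez c' v'.
  have [p [q pq]] := Bezoutz C v; apply/coprimezP; exists (p, q) => /=.
  apply: (mulfI gneq0); rewrite mulr1; transitivity (p * C + q * v); last exact: pq.
  by rewrite [in RHS]CE [in RHS]vE; ring.
(* The product g v' = v divides the squarefree d. *)
have copgv : coprimez g v'.
  by apply: squarefree_coprime sqf _; rewrite -vE /d /dE dvdz_mulr.
pose m := v' * (A * v' + g * c' ^+ 2 * u).
pose k := g * c' ^+ 3.
have mE : ((v * (A * v + C ^+ 2 * u)) %/ g ^+ 2)%Z = m.
  rewrite (_ : v * _ = m * g ^+ 2) ?mulzK ?expf_neq0 //.
  by rewrite {2}vE {1}vE CE /m; ring.
have kE : ((C ^+ 3) %/ g ^+ 2)%Z = k.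
  rewrite (_ : C ^+ 3 = k * g ^+ 2) ?mulzK ?expf_neq0 //.
  by rewrite CE /k; ring.
have BE : ((B * v ^+ 2) %/ g ^+ 2)%Z = B * v' ^+ 2.
  rewrite (_ : B * v ^+ 2 = B * v' ^+ 2 * g ^+ 2) ?mulzK ?expf_neq0 //.
  by rewrite {1}vE; ring.
have B2E : ((B ^+ 2 * v ^+ 4) %/ g ^+ 4)%Z = (B * v' ^+ 2) ^+ 2.
  rewrite (_ : B ^+ 2 * v ^+ 4 = (B * v' ^+ 2) ^+ 2 * g ^+ 4) ?mulzK ?expf_neq0 //.
  by rewrite {1}vE; ring.
have m0 : 0 < m.
  have : 0 < m * g ^+ 2.
    have -> : m * g ^+ 2 = v * (A * v + C ^+ 2 * u).
      by rewrite {2}vE {1}vE CE /m; ring.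
    exact: mulr_gt0.
  by rewrite pmulr_lgt0 ?exprn_gt0.
have copkm : coprimez k m.
  have : coprimez (g * c') m.
    rewrite /m coprimezMr coprimezMl copgv copcv /=.
    have /coprimezP[[p q] /= pq] : coprimez (g * c') (A * v').
      by rewrite -CE coprimezMr (coprimez_sym C) copA CE coprimezMl copgv copcv.
    by apply/coprimezP; exists (p - q * c' * u, q); rewrite -pq /=; ring.
  by rewrite coprimezMl => /andP[gm cm]; rewrite /k coprimezMl gm; exact: coprimezXl.
rewrite mE kE BE B2E.
have : (egcdz k m).1 * k + (egcdz k m).2 * m = 1.
  by case: egcdzP => p q /= ->; rewrite (eqP copkm).
move: (egcdz k m) => [mu s] /= mus.
pose h := mu * (B * v' ^+ 2).
(* The cofactor from [twist_coord_gt0] divided by g^2. *)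
pose q := (A * v') ^+ 2 - A * u * v' * g * c' ^+ 2 + u ^+ 2 * g ^+ 2 * c' ^+ 4
  + a4 * v' ^+ 2 * g ^+ 4 * c' ^+ 4.
have eq1 : (B * v' ^+ 2) ^+ 2 + k ^+ 2 * d = m * q.
  rewrite exprMn curve /d /dE CE /k /m /q !vE; ring.
have cE : mu ^+ 2 * (B * v' ^+ 2) ^+ 2 + d = m * (mu ^+ 2 * q + d * s * (1 + mu * k)).
  (* Splitting d as (mu k)^2 d + d (1 - mu k)(1 + mu k) makes both parts visibly divisible by m. *)
  transitivity (mu ^+ 2 * ((B * v' ^+ 2) ^+ 2 + k ^+ 2 * d) + d * (1 - mu * k) * (1 + mu * k)).
    by ring.
  have -> : 1 - mu * k = s * m by rewrite -mus; ring.
  by rewrite eq1; ring.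
exists g, m, h, (mu ^+ 2 * q + d * s * (1 + mu * k)); split=> //.
- by rewrite -/d cE mulKz ?gt_eqF //; congr (_, _, _); rewrite /h; ring.
- by rewrite -cE /h; ring.
by exists v', c', mu, s; split.
Qed.

(** * The chord and tangent law in integral coordinates *)

(** Chord and tangent are merged into Vieta's relations for the line y = l x + n; its third
    intersection is the opposite of the sum, hence [- y3]. *)
Lemma ec_add_chord (a4 a6 : int) (x1 y1 x2 y2 : rat) :
    on_curve a4 a6 (Some (x1, y1)) -> on_curve a4 a6 (Some (x2, y2)) ->
    ~~ ((x1 == x2) && (y1 == - y2)) ->
  exists l n x3 y3 : rat,
    [/\ ec_add a4 (Some (x1, y1)) (Some (x2, y2)) = Some (x3, y3),
        y1 = l * x1 + n, y2 = l * x2 + n & - y3 = l * x3 + n] /\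
    [/\ l ^+ 2 = x1 + x2 + x3, a4%:~R - 2 * l * n = x1 * x2 + x1 * x3 + x2 * x3
      & n ^+ 2 - a6%:~R = x1 * x2 * x3].
Proof.
move=> /= /eqP c1 /eqP c2.
(* Only the relation for the linear coefficient, and the passage of the line through the second
   point, depend on how the slope was obtained. *)
have conclude (l : rat) : y2 = l * x2 + (y1 - l * x1) ->
    a4%:~R - 2 * l * (y1 - l * x1)
    = x1 * x2 + x1 * (l ^+ 2 - x1 - x2) + x2 * (l ^+ 2 - x1 - x2) ->
  exists l' n x3 y3 : rat,
    [/\ Some (l ^+ 2 - x1 - x2, l * (x1 - (l ^+ 2 - x1 - x2)) - y1) = Some (x3, y3),
        y1 = l' * x1 + n, y2 = l' * x2 + n & - y3 = l' * x3 + n] /\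
    [/\ l' ^+ 2 = x1 + x2 + x3, a4%:~R - 2 * l' * n = x1 * x2 + x1 * x3 + x2 * x3
      & n ^+ 2 - a6%:~R = x1 * x2 * x3].
  move=> e2 q1.
  exists l, (y1 - l * x1), (l ^+ 2 - x1 - x2), (l * (x1 - (l ^+ 2 - x1 - x2)) - y1).
  split; split=> //; try by ring.
  have -> : a6%:~R = y1 ^+ 2 - x1 ^+ 3 - a4%:~R * x1 by rewrite c1; ring.
  have -> : a4%:~R = 2 * l * (y1 - l * x1)
    + (x1 * x2 + x1 * (l ^+ 2 - x1 - x2) + x2 * (l ^+ 2 - x1 - x2)).
    by rewrite -q1; ring.
  by ring.
have [x12|x12] := eqVneq x1 x2 => /=.
  move=> yN; rewrite (negbTE yN).
  have y12 : y1 = y2.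
    have : (y1 - y2) * (y1 + y2) == 0 by rewrite -subr_sqr c1 c2 x12 subrr.
    by rewrite mulf_eq0 subr_eq0 addr_eq0 (negbTE yN) orbF => /eqP.
  have y10 : y1 != 0.
    by apply: contra yN => /eqP y0; rewrite -y12 y0 oppr0.
  set l := _ / _; apply: conclude; first by rewrite -x12 -y12; ring.
  have -> : a4%:~R = 2 * l * y1 - 3 * x1 ^+ 2 by rewrite /l; field.
  by rewrite -x12; ring.
move=> _; set l := (y2 - y1) / (x2 - x1).
have x21 : x2 - x1 != 0 by rewrite subr_eq0 eq_sym.
have ly : l * (x2 - x1) = y2 - y1 by rewrite divfK.
have y2E : y2 = l * x2 + (y1 - l * x1) by rewrite -[LHS](subrK y1) -ly; ring.
apply: conclude => //.
have -> : a4%:~R = l * (y1 + y2) - (x1 ^+ 2 + x1 * x2 + x2 ^+ 2).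
  apply: (mulIf x21).
  transitivity (y2 ^+ 2 - y1 ^+ 2 - (x2 ^+ 3 - x1 ^+ 3)); first by rewrite c1 c2; ring.
  transitivity ((l * (x2 - x1)) * (y1 + y2) - (x2 ^+ 3 - x1 ^+ 3)); last by ring.
  by rewrite ly; ring.
by rewrite y2E; ring.
Qed.

(** * Gauss's lemma and primitive equations of lines *)

Lemma zcontents_eq1 (p : {poly int}) : 0 < lead_coef p ->
    (forall k : nat, prime k -> (forall i, (k %| p`_i)%Z) -> False) ->
  zcontents p = 1.
Proof.
move=> lp prim.
have z0 : 0 < zcontents p by rewrite -sgz_gt0 sgz_contents sgz_gt0.
apply/eqP; apply: contraT => z1; exfalso.
have k2 : (1 < `|zcontents p|)%N by move: z0 z1; clear; lia.
apply: (prim (pdiv `|zcontents p|)); first exact: pdiv_prime.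
apply/polyOverP; rewrite -dvdz_contents dvdzE; exact: pdiv_dvd.
Qed.

Lemma zcontents_linear (A C : int) :
  0 < C -> coprimez A C -> zcontents (Poly [:: - A; C ^+ 2]) = 1.
Proof.
move=> C0 AC; have C20 : C ^+ 2 != 0 by rewrite expf_neq0 // gt_eqF.
apply: zcontents_eq1.
  by rewrite lead_coefE (@PolyK _ 0) // exprn_gt0.
move=> k pk kp; have := kp 0; have := kp 1; rewrite !coef_Poly /= rpredN => kC kA.
have : (k %| gcdz A C)%Z by rewrite dvdz_gcd kA (prime_dvdzX _ _ _ pk kC).
by rewrite (eqP AC) dvdzE /= dvdn1 => /eqP k1; rewrite k1 in pk.
Qed.

(* Gauss's lemma: both cubics are primitive, hence equal. *)
Lemma primitive_chord (a4 a6 A1 C1 A2 C2 A3 C3 T L N : int)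
    (D := (C1 * C2 * C3) ^+ 2) :
    0 < C1 -> 0 < C2 -> 0 < C3 -> 0 < T ->
    coprimez A1 C1 -> coprimez A2 C2 -> coprimez A3 C3 ->
    (exists e0 e1 e2 : int, e0 * L + e1 * T + e2 * N = 1) ->
    D * L ^+ 2 = T ^+ 2 * (A1 * C2 ^+ 2 * C3 ^+ 2 + C1 ^+ 2 * A2 * C3 ^+ 2
                           + C1 ^+ 2 * C2 ^+ 2 * A3) ->
    D * (a4 * T ^+ 2 - 2 * L * N)
    = T ^+ 2 * (A1 * A2 * C3 ^+ 2 + A1 * C2 ^+ 2 * A3 + C1 ^+ 2 * A2 * A3) ->
    D * (N ^+ 2 - a6 * T ^+ 2) = T ^+ 2 * (A1 * A2 * A3) ->
  T = C1 * C2 * C3.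
Proof.
move=> C10 C20 C30 T0 cop1 cop2 cop3 [e0 [e1 [e2 bez]]] q2 q1 q0.
(* This is T^2 (X^3 + a4 X + a6) - (L X + N)^2. A prime dividing all coefficients divides T and L,
   then N, against the Bezout relation. *)
pose p := Poly [:: - (N ^+ 2 - a6 * T ^+ 2); a4 * T ^+ 2 - 2 * L * N; - L ^+ 2; T ^+ 2].
have T20 : T ^+ 2 != 0 by rewrite expf_neq0 // gt_eqF.
have zp : zcontents p = 1.
  apply: zcontents_eq1; first by rewrite lead_coefE (@PolyK _ 0) // exprn_gt0.
  move=> k pk kp.
  have := kp 3; have := kp 2; have := kp 0; rewrite !coef_Poly /= !rpredN => kN kL kT.
  have {}kL := prime_dvdzX _ _ _ pk kL.
  have {}kN : (k %| N)%Z.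
    apply: (prime_dvdzX _ _ 2 pk); rewrite -[N ^+ 2](subrK (a6 * T ^+ 2)).
    by rewrite rpredD // dvdz_mull.
  have {}kT := prime_dvdzX _ _ _ pk kT.
  have : (k %| e0 * L + e1 * T + e2 * N)%Z by rewrite !rpredD ?dvdz_mull.
  by rewrite bez dvdzE /= dvdn1 => /eqP k1; rewrite k1 in pk.
have pE : D *: p = T ^+ 2 *: (Poly [:: - A1; C1 ^+ 2] * Poly [:: - A2; C2 ^+ 2]
    * Poly [:: - A3; C3 ^+ 2]).
  rewrite /p /= !cons_poly_def -!mul_polyC.
  transitivity ((D * T ^+ 2)%:P * 'X ^+ 3 - (D * L ^+ 2)%:P * 'X ^+ 2
    + (D * (a4 * T ^+ 2 - 2 * L * N))%:P * 'X - (D * (N ^+ 2 - a6 * T ^+ 2))%:P).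
    by ring.
  by rewrite q2 q1 q0 /D; ring.
(* Comparing contents gives D = T^2, an equality of squares of positive integers. *)
have := congr1 zcontents pE.
rewrite !zcontentsZ !zcontentsM zp !zcontents_linear // !mulr1 => /eqP.
by rewrite eqrXn2 ?mulr_ge0 ?ltW // => /eqP.
Qed.

Lemma primitive_line_coef (l n : rat) : exists T L N : int,
  [/\ 0 < T, l = L%:~R / T%:~R, n = N%:~R / T%:~R
    & exists e0 e1 e2 : int, e0 * L + e1 * T + e2 * N = 1].
Proof.
pose T0 := denq l * denq n; pose L0 := numq l * denq n; pose N0 := numq n * denq l.
have T00 : 0 < T0 by rewrite mulr_gt0 ?denq_gt0.
pose r := gcdz (gcdz L0 T0) N0.
have r0 : 0 < r.
  by rewrite lt0r !gcdz_eq0 (gt_eqF T00) andbF.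
have rneq0 : r != 0 by rewrite gt_eqF.
have rd : (r %| gcdz L0 T0)%Z by exact: dvdz_gcdl.
have /dvdzP[L LE] : (r %| L0)%Z := dvdz_trans rd (dvdz_gcdl _ _).
have /dvdzP[T TE] : (r %| T0)%Z := dvdz_trans rd (dvdz_gcdr _ _).
have /dvdzP[N NE] : (r %| N0)%Z := dvdz_gcdr _ _.
have rK : (r%:~R : rat) != 0 by rewrite intr_eq0.
have lK : ((denq l)%:~R : rat) != 0 by rewrite intr_eq0 denq_neq0.
have nK : ((denq n)%:~R : rat) != 0 by rewrite intr_eq0 denq_neq0.
have T_gt0 : 0 < T by move: T00; rewrite TE pmulr_lgt0.
have TK : (T%:~R : rat) != 0 by rewrite intr_eq0 gt_eqF.
exists T, L, N; split=> //.
- rewrite -{1}(divq_num_den l); apply: (@mulIf _ (T0%:~R)).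
    by rewrite intr_eq0 gt_eqF.
  transitivity (L0%:~R : rat); first by rewrite /T0 /L0; field.
  by rewrite LE TE; field.
- rewrite -{1}(divq_num_den n); apply: (@mulIf _ (T0%:~R)).
    by rewrite intr_eq0 gt_eqF.
  transitivity (N0%:~R : rat); first by rewrite /T0 /N0; field.
  by rewrite NE TE; field.
have [x [y xy]] := Bezoutz L0 T0; have [z [t zt]] := Bezoutz (gcdz L0 T0) N0.
exists (z * x), (z * y), t; apply: (mulIf rneq0); rewrite mul1r.
transitivity (z * (x * L0 + y * T0) + t * N0); last by rewrite xy.
by rewrite LE TE NE; ring.
Qed.

(** * The line through P, Q and -(P + Q) *)

Definition ec_proj (P : ptQ) : int * int * int :=
  proj_coord (ec_coord P).1.1 (ec_coord P).1.2 (ec_coord P).2.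

(** The integer a = A v + C^2 u of [Phi], equal to v at infinity. *)
Definition ec_height (u v : int) (P : ptQ) : int :=
  (ec_coord P).1.1 * v + (ec_coord P).2 ^+ 2 * u.

Lemma ec_add_line_cuts (K : numClosedFieldType) (d : int) (w : K)
    (a4 a6 u v : int) (P Q : ptQ) :
    w ^+ 2 = - d%:~R -> w^* = - w -> d = dE a4 a6 u v ->
    on_curve a4 a6 P -> on_curve a4 a6 Q ->
  on_curve a4 a6 (ec_add a4 P Q) /\
  exists2 l, line_cuts K a4 a6 l (ec_proj P) (ec_proj Q)
               (ec_proj (ec_opp (ec_add a4 P Q)))
    & dot3 K (int3 K l) (twist_pt K w u v) * (dot3 K (int3 K l) (twist_pt K w u v))^*
      = (v * (ec_height u v P * ec_height u v Q
              * ec_height u v (ec_opp (ec_add a4 P Q))))%:~R.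
Proof.
move=> w2 conj_w dE_eq.
case: P => [[x1 y1]|]; case: Q => [[x2 y2]|] c1 c2; last first.
- split=> //; exists (0, 0, 1); first exact: infinity_line_cuts.
  exact: infinity_line_norm.
- split=> //.
  have [_ [copA _ curve]] := ec_coord_SomeP _ _ _ _ c2.
  eexists; first by rewrite /ec_proj ec_coord_opp; apply: line_cuts_perm;
    apply: vertical_line_cuts.
  by rewrite vertical_line_norm /ec_height ec_coord_opp /=; ring.
- split=> //.
  have [_ [copA _ curve]] := ec_coord_SomeP _ _ _ _ c1.
  (* Starting from -P, two cyclic shifts produce the order P, O, -P. *)
  have := vertical_line_cuts K _ _ _ _ _ copA (etrans (sqrrN _) curve).
  rewrite opprK => cut; eexists.
    by rewrite /ec_proj ec_coord_opp; do 2 apply: line_cuts_perm; exact: cut.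
  by rewrite vertical_line_norm /ec_height ec_coord_opp /=; ring.
have [/andP[/eqP x12 /eqP y12]|nopp] := boolP ((x1 == x2) && (y1 == - y2)).
  have -> : ec_add a4 (Some (x1, y1)) (Some (x2, y2)) = None.
    by rewrite /= x12 y12 !eqxx.
  have -> : Some (x2, y2) = ec_opp (Some (x1, y1)) by rewrite /= x12 y12 opprK.
  split=> //; have [_ [copA _ curve]] := ec_coord_SomeP _ _ _ _ c1.
  eexists; first by rewrite /ec_proj ec_coord_opp; apply: vertical_line_cuts.
  by rewrite vertical_line_norm /ec_height ec_coord_opp /=; ring.
have [l [n [x3 [y3 [[-> l1 l2 l3] [q2 q1 q0]]]]]] := ec_add_chord _ _ _ _ _ _ c1 c2 nopp.
have c3 : on_curve a4 a6 (Some (x3, - y3)).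
  apply/eqP; rewrite l3.
  have -> : a6%:~R = n ^+ 2 - x1 * x2 * x3 by rewrite -q0; ring.
  have -> : a4%:~R = 2 * l * n + (x1 * x2 + x1 * x3 + x2 * x3) by rewrite -q1; ring.
  by ring: q2.
split; first by move: c3; rewrite /= sqrrN.
rewrite /ec_height /ec_proj /ec_opp.
have [[C10 x1E y1E] [cop1 _ _]] := ec_coord_SomeP _ _ _ _ c1.
have [[C20 x2E y2E] [cop2 _ _]] := ec_coord_SomeP _ _ _ _ c2.
have [[C30 x3E y3E] [cop3 _ _]] := ec_coord_SomeP _ _ _ _ c3.
rewrite /ec_coord /=.
move: (numq x1) (numq y1) (denq y1 %/ denq x1)%Z C10 x1E y1E cop1
  => A1 B1 C1 C10 x1E y1E cop1.
move: (numq x2) (numq y2) (denq y2 %/ denq x2)%Z C20 x2E y2E cop2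
  => A2 B2 C2 C20 x2E y2E cop2.
move: (numq x3) (numq (- y3)) (denq (- y3) %/ denq x3)%Z C30 x3E y3E cop3
  => A3 B3 C3 C30 x3E y3E cop3.
have [T [L [N [T0 lE nE bez]]]] := primitive_line_coef l n.
have intr0 (k : int) : 0 < k -> (k%:~R : rat) != 0.
  by move=> k0; rewrite intr_eq0 gt_eqF.
have [[[T0' C10'] C20'] C30'] := (intr0 _ T0, intr0 _ C10, intr0 _ C20, intr0 _ C30).
set D := (C1 * C2 * C3) ^+ 2.
have E2 : D * L ^+ 2 = T ^+ 2 * (A1 * C2 ^+ 2 * C3 ^+ 2 + C1 ^+ 2 * A2 * C3 ^+ 2
    + C1 ^+ 2 * C2 ^+ 2 * A3).
  apply: (@intr_inj rat); transitivity (D%:~R * T%:~R ^+ 2 * l ^+ 2).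
    by rewrite lE; field.
  by rewrite q2 x1E x2E x3E /D; field; rewrite C10' C20' C30'.
have E1 : D * (a4 * T ^+ 2 - 2 * L * N)
    = T ^+ 2 * (A1 * A2 * C3 ^+ 2 + A1 * C2 ^+ 2 * A3 + C1 ^+ 2 * A2 * A3).
  apply: (@intr_inj rat); transitivity (D%:~R * T%:~R ^+ 2 * (a4%:~R - 2 * l * n)).
    by rewrite lE nE; field.
  by rewrite q1 x1E x2E x3E /D; field; rewrite C10' C20' C30'.
have E0 : D * (N ^+ 2 - a6 * T ^+ 2) = T ^+ 2 * (A1 * A2 * A3).
  apply: (@intr_inj rat); transitivity (D%:~R * T%:~R ^+ 2 * (n ^+ 2 - a6%:~R)).
    by rewrite nE; field.
  by rewrite q0 x1E x2E x3E /D; field; rewrite C10' C20' C30'.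
(* The common denominator of the primitive line is thus determined, so the factors T^2 cancel from
   the Vieta relations. *)
have TE : T = C1 * C2 * C3 by apply: primitive_chord bez E2 E1 E0.
rewrite {}/D -TE in E2 E1 E0.
have T20 : T ^+ 2 != 0 by rewrite expf_neq0 // gt_eqF.
have lineE (x y : rat) (A B C : int) : 0 < C -> x = A%:~R / C%:~R ^+ 2 ->
    y = B%:~R / C%:~R ^+ 3 -> y = l * x + n ->
    C1 * C2 * C3 * B = (L * A + N * C ^+ 2) * C.
  move=> /intr0 C0 -> yE; rewrite {}yE lE nE -TE => e.
  apply: (@intr_inj rat).
  transitivity (T%:~R * C%:~R ^+ 3 * (B%:~R / C%:~R ^+ 3) : rat); first by field.
  by rewrite e; field; rewrite T0' C0.
have [] := @chord_line_cuts K d w w2 conj_w a4 a6 u v dE_eq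
  A1 B1 C1 A2 B2 C2 A3 B3 C3 L N; rewrite -?TE //.
- by rewrite TE; apply: lineE y1E l1.
- by rewrite TE; apply: lineE y2E l2.
- by rewrite TE; apply: lineE y3E l3.
- by apply: (mulfI T20); rewrite E2.
- by apply: (mulfI T20); rewrite E1.
- by apply: (mulfI T20); rewrite E0.
by move=> cut Nl; exists (L, - T, N).
Qed.

(** * Opposite points and the homomorphism law *)

(** Negating a point conjugates its lattice. The point at infinity is its own opposite, which is
    consistent because h = 0 there. *)
Lemma Phi_data_ec_opp (a4 a6 u v : int) (P : ptQ) (g m h c : int) :
    Phi a4 a6 u v P = (m, 2 * h, c) ->
    Phi_data u v (ec_coord P).1.1 (ec_coord P).1.2 (ec_coord P).2 g m h ->
  Phi_data u v (ec_coord (ec_opp P)).1.1 (ec_coord (ec_opp P)).1.2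
    (ec_coord (ec_opp P)).2 g m (- h).
Proof.
case: P => [[x y]|] PhiE; first by rewrite ec_coord_opp; exact: Phi_data_opp.
by case: PhiE => _ h0 _; have -> : h = 0 by move: h0; clear; lia.
Qed.

Lemma on_curve_opp (a4 a6 : int) (P : ptQ) :
  on_curve a4 a6 P -> on_curve a4 a6 (ec_opp P).
Proof. by case: P => [[x y]|] //=; rewrite sqrrN. Qed.

Theorem theorem1p1 (a4 a6 u v : int) :
  4 * a4 ^+ 3 + 27 * a6 ^+ 2 != 0 ->
  map_suitable a4 a6 u v ->
  fundamental_disc (- DE a4 a6 u v) ->
  forall P Q : ptQ, on_curve a4 a6 P -> on_curve a4 a6 Q ->
  forall f1 f2 F : bqf,
    bqf_equiv (Phi a4 a6 u v P) f1 ->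
    bqf_equiv (Phi a4 a6 u v Q) f2 ->
    dirichlet_comp f1 f2 F ->
    bqf_equiv (Phi a4 a6 u v (ec_add a4 P Q)) F.
Proof.
move=> _ suit /fundamental_disc_4[sqf d4] P Q cP cQ f1 f2 F.
have [_ [v0 [_ D0]]] := suit.
set d := dE a4 a6 u v in sqf d4.
have d0 : 0 < d by move: D0; rewrite /DE pmulr_rgt0.
(* Since d is positive, its root is real and conjugation negates [w]. *)
pose w : algC := 'i * sqrtC d%:~R.
have w2 : w ^+ 2 = - d%:~R by rewrite exprMn sqrCi sqrtCK mulN1r.
have conj_w : w^* = - w.
  rewrite rmorphM /= conjCi conj_Creal ?mulNr //.
  by rewrite sqrtC_real // ler0z ltW.
have copv : coprimez v (u ^+ 3 + a4 * u * v ^+ 2 - a6 * v ^+ 3).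
  exact: squarefree_coprime sqf (dvdzz _).
have [cS [l cut Nl]] := ec_add_line_cuts _ _ _ _ _ _ _ _ _ w2 conj_w (erefl d) cP cQ.
have [g1 [m1 [h1 [c1 [-> m10 e1 D1]]]]] := Phi_dataP _ _ _ _ _ suit sqf cP.
have [g2 [m2 [h2 [c2 [-> m20 e2 D2]]]]] := Phi_dataP _ _ _ _ _ suit sqf cQ.
have [g3 [m3 [h3 [c3 [PhiS m30 e3 D3]]]]] := Phi_dataP _ _ _ _ _ suit sqf cS.
(* The third collinear point is -(P + Q), so the conjugate lattice, with [- h3], enters. *)
have [b Nb bP] := line_cuts_product _ _ _ d0 w2 _ _ _ _ (erefl d) v0 copv _
  _ _ _ _ _ _ _ _ _ _ _ _ _ _ _ _ _ _ (ec_coord_coprime _ _ _ cP)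
  (ec_coord_coprime _ _ _ cQ) (ec_coord_coprime _ _ _ (on_curve_opp _ _ _ cS))
  D1 D2 (Phi_data_ec_opp _ _ _ _ _ _ _ _ _ PhiS D3) cut Nl.
rewrite PhiS.
apply: (lattice_product_equiv _ _ _ d0 w2 conj_w _ _ _ _ _ _ _ _ _ _ _ _ _
  m10 m20 m30 e1 e2 e3 _ _ Nb bP); exact: (fundamental_primitive d).
Qed.
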